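(* Consider a regime $n,d\to\infty$, where $d=d_1d_2$, and data $A_i=M_{s_i^*}+E_i$, $i\in[n]$, with fixed labels $s_i^*\in[K]$, mean matrices $M_1,\dots,M_K\in\mathbb{R}^{d_1\times d_2}$ and noise matrices $E_i$ whose entries are i.i.d. Gaussian with mean zero and variance $\sigma^2$. Let $\mathcal{G}=([n],\mathcal{E})$ be a graph with $\kappa_0$ connected components and incidence matrix $B\in\mathbb{R}^{n\times|\mathcal{E}|}$, with edge weights satisfying $\min_{l(i,j)\in\mathcal{E}}w_{ij}\ge\frac12$. Suppose that $$\frac{1}{\sigma_{\min}(B)}\sqrt{\frac{|\mathcal{E}|^2\log(d|\mathcal{E}|)}{dn^2}}=o(1),$$ and that $\kappa_0$, $\widetilde{w}_{\max}:=\max_{l(i,j)\in\mathcal{E}}w_{ij}$, $\tau_{\max}:=\max_{\alpha\in[K]}\|M_\alpha\|_*$ and $\Delta_{\max}:=\max_{\alpha,\beta\in[K]}\|M_\alpha-M_\beta\|_F$ are all $O(1)$. Given any $c\ge1$, choose $$\gamma_1=c\cdot\frac{4\sigma\sqrt{d\log(d|\mathcal{E}|)}}{\sigma_{\min}(B)},\qquad \gamma_2=o\big(\min\{n^{1/4},d\}\big).$$ Then the solution $(X_1^*,\dots,X_n^* )$ of the low rank convex clustering problem satisfies $$\frac{1}{2dn}\sum_{i=1}^n\|X_i^*-M_{s_i^*}\|_F^2\le\sigma^2\left[\frac{\kappa_0}{n}+\sqrt{\frac{\kappa_0\log(dn)}{dn^2}}\right]+\frac{\gamma_1}{2dn}\sum_{l(i,j)\in\mathcal{E}}(1+2w_{ij})\|M_{s_i^*}-M_{s_j^*}\|_F+\gamma_2\left[\frac{\sigma}{n^{1/4}}+\frac{1}{dn}\sum_{i=1}^n\|M_{s_i^*}\|_*\right]$$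 with probability at least $$1-\frac{2}{d|\mathcal{E}|}-2\exp\left(-\frac{\sqrt{d^3n}}{2}\right)-\exp\left\{-\min\left(c_1\log(dn),\ c_2\sqrt{d\kappa_0\log(dn)}\right)\right\}$$ for some positive constants $c_1,c_2$, and the right-hand side of the bound tends to $0$ as $n,d\to\infty$.
   Context: Assume $d_1\ge d_2$. $[n]=\{1,\dots,n\}$; $\|\cdot\|_F$ is the Frobenius norm, $\|\cdot\|_*$ the nuclear norm. $\mathcal{G}=([n],\mathcal{E})$ is an undirected graph, $l(i,j)\in\mathcal{E}$ ($i<j$) denotes the edge joining $i$ and $j$, with positive weight $w_{ij}$. The incidence matrix $B$ is the oriented one: the column indexed by $l(i,j)$ is $e_i-e_j$. $\sigma_{\min}(B)$ is the minimum nonzero singular value of $B$. The noise level $\sigma>0$ is a fixed constant; $\mathcal{G}$, the weights, $K$ and the means $M_\alpha$ may vary with $n,d$ subject to the stated assumptions. The low rank convex clustering problem is $$\min_{X_1,\dots,X_n\in\mathbb{R}^{d_1\times d_2}}\ \frac12\sum_{i=1}^n\|X_i-A_i\|_F^2+\gamma_1\sum_{l(i,j)\in\mathcal{E}}w_{ij}\|X_i-X_j\|_F+\gamma_2\sum_{i=1}^n\|X_i\|_*,\qquad \gamma_1,\gamma_2>0,$$ which has a unique optimal solution $(X_1^*,\dots,X_n^* )$. *)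

(* Defs.v *)
From HB Require Import structures.
From mathcomp Require Import all_boot all_order all_algebra.
From mathcomp Require Import polyrcf.
From mathcomp Require Import all_classical all_reals all_analysis.

Set Implicit Arguments.
Unset Strict Implicit.
Unset Printing Implicit Defensive.

Import Order.TTheory GRing.Theory Num.Theory.
Import numFieldNormedType.Exports.

Local Open Scope classical_set_scope.
Local Open Scope ring_scope.

Section matrix_norms.
Variable R : realType.
Implicit Types p q : nat.

Definition frobenius_norm p q (A : 'M[R]_(p, q)) : R :=
  Num.sqrt (\sum_i \sum_j A i j ^+ 2).

(* Square roots of the eigenvalues of A^T A, each repeated according to its
   algebraic multiplicity: q values in total, so when p < q at least q - p of
   them are zeros in excess of the usual min(p, q) singular values. This
   affects neither their sum nor the smallest nonzero one. *)
Definition singular_values p q (A : 'M[R]_(p, q)) : seq R :=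
  let chi := char_poly (A^T *m A) in
  flatten [seq nseq (mup x chi) (Num.sqrt x) | x <- rootsR chi].

Definition nuclear_norm p q (A : 'M[R]_(p, q)) : R :=
  \sum_(s <- singular_values A) s.

(* Smallest nonzero singular value; 0 for the zero matrix, which has none. *)
Definition sigma_min p q (A : 'M[R]_(p, q)) : R :=
  head 0 (sort <=%R [seq s <- singular_values A | s != 0]).

End matrix_norms.

Section graphs.
Variables (R : realType) (n : nat) (e : rel 'I_n).

(* Each undirected edge is listed once, as the pair (i, j) with i < j. *)
Definition edges : {set 'I_n * 'I_n} :=
  [set p : 'I_n * 'I_n | (p.1 < p.2)%N && e p.1 p.2]%SET.

Definition incidence_mx : 'M[R]_(n, #|edges|) :=
  \matrix_(i, l) ((i == (enum_val l).1)%:R - (i == (enum_val l).2)%:R).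

Definition num_components : nat := n_comp e predT.

(* The maxima below are of nonnegative numbers, hence the neutral element 0. *)
Definition max_weight (w : 'I_n -> 'I_n -> R) : R :=
  \big[Num.max/0]_(p in edges) w p.1 p.2.

End graphs.

Section mean_matrices.
Variables (R : realType) (d1 d2 K : nat) (M : 'I_K -> 'M[R]_(d1, d2)).

Definition tau_max : R := \big[Num.max/0]_(a < K) nuclear_norm (M a).

Definition Delta_max : R :=
  \big[Num.max/0]_(a < K) \big[Num.max/0]_(b < K) frobenius_norm (M a - M b).

End mean_matrices.

Section clustering.
Variables (R : realType) (n d1 d2 : nat) (e : rel 'I_n) (w : 'I_n -> 'I_n -> R).
Variables (gamma1 gamma2 : R).

Definition clustering_objective (A X : 'I_n -> 'M[R]_(d1, d2)) : R :=
  2^-1 * (\sum_i frobenius_norm (X i - A i) ^+ 2)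
  + gamma1 * (\sum_(p in edges e) w p.1 p.2 * frobenius_norm (X p.1 - X p.2))
  + gamma2 * (\sum_i nuclear_norm (X i)).

Definition clustering_solution (A X : 'I_n -> 'M[R]_(d1, d2)) : Prop :=
  forall Y, clustering_objective A X <= clustering_objective A Y.

Definition estimation_error_bound (sigma : R) (K : nat)
    (M : 'I_K -> 'M[R]_(d1, d2)) (s : 'I_n -> 'I_K) : R :=
  let d := (d1 * d2)%N in
  let kappa0 := num_components e in
  sigma ^+ 2 * (kappa0%:R / n%:R
                + Num.sqrt (kappa0%:R * ln (d * n)%:R / (d * n ^ 2)%:R))
  + gamma1 / (2 * d * n)%:R
    * (\sum_(p in edges e) (1 + 2 * w p.1 p.2)
                           * frobenius_norm (M (s p.1) - M (s p.2)))
  + gamma2 * (sigma / (n%:R `^ 4^-1)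
              + (d * n)%:R^-1 * (\sum_i nuclear_norm (M (s i)))).

End clustering.

Section noise.
Variables (R : realType) (disp : measure_display) (T : measurableType disp).
Variable P : probability T R.

Definition mutually_independent (I : finType) (X : I -> {RV P >-> R}) : Prop :=
  forall (J : {set I}) (V : I -> set R), (forall i, measurable (V i)) ->
    P (\bigcap_(i in [set` J]) (X i @^-1` V i))
    = (\prod_(i in J) P (X i @^-1` V i))%E.

(* normal_prob takes the standard deviation. The two laws are compared on
   Borel sets only: outside them both sides are junk values. *)
Definition iid_gaussian (I : finType) (sigma : R) (X : I -> {RV P >-> R}) :
    Prop :=
  mutually_independent X /\
  forall i (V : set R), measurable V ->
    distribution P (X i) V = normal_prob 0 sigma V.

Definition noisy_data (n d1 d2 K : nat) (M : 'I_K -> 'M[R]_(d1, d2))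
    (s : 'I_n -> 'I_K) (E : 'I_n * 'I_d1 * 'I_d2 -> {RV P >-> R}) (omega : T) :
    'I_n -> 'M[R]_(d1, d2) :=
  fun i => M (s i) + \matrix_(k, l) E (i, k, l) omega.

End noise.

(* Main.v *)
Require Import Defs.
From HB Require Import structures.
From mathcomp Require Import all_boot all_order all_algebra.
From mathcomp Require Import polyrcf complex sesquilinear spectral.
From mathcomp Require Import all_classical all_reals all_analysis.
From mathcomp Require Import measurable_realfun.
From mathcomp Require Import ring lra.

(**
Write D = X - M for the error of the solution X, N for the noise, and
S = sum_c |Z_c|^2 for the energy of the projection P N of the noise onto the
families that are constant on the connected components of the graph. With B
the incidence matrix, 1 - P = B Bp where Bp is the pseudo-inverse of B, whose
rows have norm at most 1 / sigma_min B.

Comparing the objective at X and at M bounds |D|^2 / 2 by <N, D> plus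
penalties. The part <(1 - P) N, D> equals the sum over edges of
<(Bp N)_l, D_i - D_j>, and the fusion penalty absorbs it as soon as all
|(Bp N)_l| are at most gamma1 / 2; this holds outside an event of probability
2 / (d |E|), by a union bound over the Gaussian entries of Bp N. The part
<P N, D> cannot be absorbed. Moving X in the direction - P N leaves the fusion
penalty unchanged and moves each nuclear norm by at most
sqrt d2 |(P N)_i|, so optimality of X gives
<P N, D> <= S + gamma2 sqrt d2 sum_i |(P N)_i| <= S + gamma2 sqrt (d2 n S).
Finally S / sigma^2 is a chi-square variable with d kappa0 degrees of freedom,
so S <= sigma^2 (d kappa0 + sqrt (d kappa0 log (dn))) with the last
probability of the statement. As kappa0 is bounded, this S is at most
sigma^2 d sqrt n for large n, and the cross term gamma2 sqrt (d2 n S) costs at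
most d n gamma2 sigma / n^(1/4).
*)

Set Implicit Arguments.
Unset Strict Implicit.
Unset Printing Implicit Defensive.

Import Order.TTheory GRing.Theory Num.Theory.
Import numFieldNormedType.Exports.

Local Open Scope classical_set_scope.
Local Open Scope ring_scope.

(** * The real spectral theorem *)

Section spectral.
Variable R : rcfType.
Implicit Types n p q : nat.

(** Over the complex extension [S] becomes Hermitian, so the complex spectral theorem diagonalizes
    it with a real diagonal; the first diagonal entry [a] is the eigenvalue sought. *)
Lemma symmetric_real_eigenvector n (S : 'M[R]_n.+1) : S^T = S ->
  exists (v : 'rV[R]_n.+1) (a : R), v != 0 /\ v *m S = a *: v.
Proof.
move=> symS; pose f := real_complex R.
pose C := map_mx f S.
have Cherm : C \is hermsymmx.
  apply: realsym_hermsym.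
    apply/is_hermitianmxP; rewrite expr0 scale1r.
    by apply/matrixP => i j; rewrite !mxE /= -[in LHS]symS mxE.
  by apply/mxOverP => i j; rewrite mxE; apply/complex_realP; exists (S i j).
have /hermitian_normalmx /orthomx_spectralP CE := Cherm.
have realD := hermitian_spectral_diag_real Cherm.
have unitP := spectral_unit C.
set P := spectralmx C in CE unitP; set D := spectral_diag C in CE realD.
have /mxOverP /(_ 0 0) /complex_realP [a Da] := realD.
have : eigenvalue C (f a).
  apply/eigenvalueP; exists (row 0 P).
    rewrite -row_mul {1}CE !mulmxA mulmxV // mul1mx.
    by rewrite row_mul row_diag_mx -scalemxAl -rowE Da.
  apply/eqP => P0; have : row 0 (P *m invmx P) = 0 by rewrite row_mul P0 mul0mx.
  rewrite mulmxV // => /rowP /(_ 0); rewrite !mxE eqxx => /eqP.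
  by rewrite oner_eq0.
(* The characteristic polynomial of [C] is the image of that of [S], so [a] is already a root over
   [R] and has a real eigenvector. *)
rewrite eigenvalue_root_char -map_char_poly fmorph_root -eigenvalue_root_char.
by move=> /eigenvalueP [v vS v0]; exists v, a.
Qed.

Lemma row_sqr_normE n (u : 'rV[R]_n) : (u *m u^T) 0 0 = \sum_i u 0 i ^+ 2.
Proof. by rewrite mxE; apply: eq_bigr => i _; rewrite mxE expr2. Qed.

Lemma row_sqr_norm_eq0 n (u : 'rV[R]_n) : (u *m u^T) 0 0 = 0 -> u = 0.
Proof.
rewrite row_sqr_normE => /eqP; rewrite psumr_eq0 => [/allP uall|i _]; last first.
  exact: sqr_ge0.
apply/rowP => i; rewrite mxE; apply/eqP; rewrite -sqrf_eq0.
exact: uall (mem_index_enum _).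
Qed.

(** The Householder reflection along [v - e] exchanges the unit vector [v] and the first basis
    vector [e]. *)
Lemma orthogonal_first_row n (v : 'rV[R]_n.+1) : v *m v^T = 1%:M ->
  exists H : 'M[R]_n.+1, H *m H^T = 1%:M /\ delta_mx 0 0 *m H = v.
Proof.
move=> v1; pose e : 'rV[R]_n.+1 := delta_mx 0 0.
have [->|ve] := eqVneq v e; first by exists 1%:M; rewrite trmx1 !mulmx1.
pose u := v - e; pose c := (u *m u^T) 0 0.
have e1 : e *m e^T = 1%:M.
  by rewrite trmx_delta mul_delta_mx; apply/rowP => i; rewrite !ord1 !mxE.
have ev : e *m v^T = v *m e^T 
  by apply/rowP => i; rewrite !ord1 !mxE; apply: eq_bigr => k _; rewrite !mxE mulrC.
pose m := (v *m e^T) 0 0; have mE : v *m e^T = m%:M by rewrite [LHS]mx11_scalar.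
have uE : u *m u^T = c%:M by rewrite [LHS]mx11_scalar.
have sB (x y : R) : x%:M - y%:M = (x - y)%:M :> 'M[R]_1 by rewrite raddfB.
have eu : e *m u^T = (m - 1)%:M.
  by rewrite [u^T]linearB /= mulmxBr e1 ev mE sB.
have cE : c = 2 - 2 * m.
  have : u *m u^T = (2 - 2 * m)%:M.
    rewrite {1}/u mulmxBl eu [u^T]linearB /= mulmxBr v1 mE !sB.
    by congr (_%:M); ring.
  by rewrite uE => /rowP /(_ 0); rewrite !mxE eqxx !mulr1n.
have c0 : c != 0.
  by apply: contra_neq ve => /row_sqr_norm_eq0 /eqP; rewrite subr_eq0 => /eqP.
pose H := 1%:M - (2 / c) *: (u^T *m u).
have Hsym : H^T = H.
  by rewrite /H linearB /= linearZ /= trmx_mul trmxK trmx1.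
exists H; split; last first.
  rewrite /H mulmxBr mulmx1 -scalemxAr mulmxA -/e eu mul_scalar_mx scalerA.
  have -> : 2 / c * (m - 1) = -1 by rewrite cE in c0 *; field.
  by rewrite scaleN1r opprK addrC subrK.
rewrite Hsym /H mulmxBr mulmx1 mulmxBl mul1mx -!scalemxAr -!scalemxAl.
rewrite mulmxA -(mulmxA _ u) uE mul_mx_scalar -scalemxAl !scalerA.
have -> : 2 / c * (2 / c) * c = 2 / c + 2 / c by field.
by rewrite scalerDl opprB addrK subrK.
Qed.

(* Each step splits off one eigenvector, moved to the first basis vector by a
   reflection. *)
Lemma symmetric_spectral n (S : 'M[R]_n) : S^T = S ->
  exists (U : 'M[R]_n) (l : 'rV[R]_n),
    U *m U^T = 1%:M /\ S = U^T *m diag_mx l *m U.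
Proof.
elim: n S => [|n IHn] S symS.
  by exists 0, 0; split; apply/matrixP; case.
have [v0 [a [v0N v0S]]] := symmetric_real_eigenvector symS.
pose c := (v0 *m v0^T) 0 0.
have c_gt0 : 0 < c.
  rewrite lt_def; apply/andP; split.
    by apply: contra_neq v0N => /row_sqr_norm_eq0.
  by rewrite /c row_sqr_normE sumr_ge0 // => i _; exact: sqr_ge0.
pose v := (Num.sqrt c)^-1 *: v0.
have v1 : v *m v^T = 1%:M.
  rewrite /v linearZ /= -scalemxAr -scalemxAl scalerA [v0 *m v0^T]mx11_scalar -/c.
  by rewrite scale_scalar_mx -invfM -expr2 sqr_sqrtr ?ltW // mulVf // gt_eqF.
have vS : v *m S = a *: v by rewrite -scalemxAl v0S !scalerA mulrC.
have [H [HH Hv]] := orthogonal_first_row v1.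
pose T := H *m S *m H^T.
have symT : T^T = T by rewrite /T !trmx_mul trmxK symS mulmxA.
have rowT : delta_mx 0 0 *m T = a *: (delta_mx 0 0 : 'rV_n.+1).
  by rewrite /T !mulmxA Hv vS -scalemxAl -Hv -mulmxA HH mulmx1.
have T0 j : T 0 j = a * (j == 0)%:R.
  by move/rowP: rowT => /(_ j); rewrite -rowE !mxE.
have TdefE : T = H *m S *m H^T by [].
(* The dimension is read as [1 + n] to use block matrices: the first row of [T] is [a] times the
   first basis vector, and symmetry gives the same for the first column. *)
clearbody T; pose T' : 'M[R]_(1 + n) := T.
have T'0 (j : 'I_(1 + n)) : T' (lshift n (0 : 'I_1)) j = a * (j == lshift n (0 : 'I_1))%:R.
  have -> : lshift n (0 : 'I_1) = (0 : 'I_n.+1) by exact: val_inj.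
  exact: T0.
have TE : T' = block_mx a%:M 0 0 (drsubmx T').
  rewrite -[LHS]submxK; congr block_mx; apply/matrixP => i j.
  - by rewrite !mxE !ord1 T'0 eqxx mulr1.
  - by rewrite !mxE !ord1 T'0 eq_rlshift mulr0.
  - have -> : T' = T'^T by rewrite /T' symT.
    by rewrite !mxE !ord1 T'0 eq_rlshift mulr0.
have symD : (drsubmx T')^T = drsubmx T' by rewrite trmx_drsub /T' symT.
have [U [l [UU DE]]] := IHn _ symD.
pose V : 'M[R]_(1 + n) := block_mx 1%:M 0 0 U.
have VV : V *m V^T = 1%:M.
  rewrite /V tr_block_mx mulmx_block !trmx0 trmx1 UU.
  by rewrite !(mulmx1, mul1mx, mulmx0, mul0mx, addr0, add0r) -scalar_mx_block.
have VTV : V^T *m diag_mx (row_mx a%:M l) *m V = T'.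
  rewrite TE DE /V tr_block_mx diag_mx_row !mulmx_block !trmx0 trmx1.
  rewrite !(mulmx1, mul1mx, mulmx0, mul0mx, addr0, add0r).
  congr block_mx; apply/matrixP => i j; rewrite !mxE !ord1 //=.
exists (V *m H), (row_mx a%:M l); split.
  by rewrite trmx_mul mulmxA -(mulmxA _ H) HH mulmx1 VV.
rewrite trmx_mul !mulmxA -(mulmxA H^T) -(mulmxA H^T) VTV /T' TdefE.
have HH' : H^T *m H = 1%:M by apply: mulmx1C.
by rewrite !mulmxA HH' mul1mx -mulmxA HH' mulmx1.
Qed.

End spectral.

(** * Singular values *)

Section singular_values.
Variable R : realType.
Implicit Types p q : nat.

(** Since [U^T U = 1], the matrix [X - U^T diag(l) U] equals [U^T (X - diag(l)) U], and the two
    outer determinants cancel. *)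
Lemma char_poly_conj n (U : 'M[R]_n) (l : 'rV[R]_n) : U *m U^T = 1%:M ->
  char_poly (U^T *m diag_mx l *m U) = \prod_j ('X - (l 0 j)%:P).
Proof.
move=> UU; have UU' : U^T *m U = 1%:M by exact: mulmx1C.
rewrite -[RHS](_ : char_poly (diag_mx l) = _); last first.
  rewrite char_poly_trig; last exact: diag_mx_is_trig.
  by apply: eq_bigr => i _; rewrite mxE eqxx mulr1n.
pose V := map_mx polyC U.
have VV : V *m V^T = 1%:M by rewrite map_trmx -map_mxM UU map_mx1.
have VV' : V^T *m V = 1%:M by exact: mulmx1C.
rewrite /char_poly /char_poly_mx !map_mxM -map_trmx -/V.
have -> : 'X%:M - V^T *m map_mx polyC (diag_mx l) *m V
    = V^T *m ('X%:M - map_mx polyC (diag_mx l)) *m V.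
  by rewrite mulmxBr mulmxBl mul_mx_scalar -scalemxAl VV' scalemx1.
rewrite !det_mulmx mulrAC -det_mulmx VV' det1 mul1r //.
Qed.

(** The multiplicity of [x] as a root of the product of the [X - l_j] is the number of [j] with
    [l_j = x]. Hence any orthogonal diagonalization of [A^T A] may be used to compute singular
    values. *)
Lemma singular_values_perm p q (A : 'M[R]_(p, q)) (U : 'M[R]_q) (l : 'rV[R]_q) :
  U *m U^T = 1%:M -> A^T *m A = U^T *m diag_mx l *m U ->
  perm_eq (singular_values A) [seq Num.sqrt (l 0 j) | j <- enum 'I_q].
Proof.
move=> UU AE; rewrite /singular_values AE char_poly_conj //.
set chi := \prod_j _; pose s := [seq l 0 j | j <- enum 'I_q].
have chiE : chi = \prod_(x <- s) ('X - x%:P) by rewrite big_map big_enum.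
rewrite (map_comp Num.sqrt) -/s.
have -> : [seq nseq (mup x chi) (Num.sqrt x) | x <- rootsR chi]
    = [seq [seq Num.sqrt y | y <- t] | t <- [seq nseq (count_mem x s) x | x <- rootsR chi]].
  rewrite -map_comp; apply: eq_map => x /=.
  by rewrite chiE mu_prod_XsubC map_nseq.
rewrite -map_flatten; apply: perm_map.
have chi0 : chi != 0.
  by rewrite chiE; apply/monic_neq0/monic_prod => i _; exact: monicXsubC.
apply: (perm_trans _ (perm_count_undup s)).
apply: perm_flatten; apply: perm_map; apply: uniq_perm.
- exact: uniq_roots.
- exact: undup_uniq.
move=> x; rewrite mem_undup -roots_on_rootsR // !inE /=.
by rewrite chiE root_prod_XsubC.
Qed.

(** The rows of [U] are right singular vectors: the Gram matrix of the columns of [A U^T] is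
    [diag(l)], so [l_j] is the squared norm of column [j], and the column vanishes with it. *)
Lemma gram_spectral p q (A : 'M[R]_(p, q)) :
  exists (U : 'M[R]_q) (l : 'rV[R]_q),
    [/\ U *m U^T = 1%:M, A^T *m A = U^T *m diag_mx l *m U,
        forall j, l 0 j = \sum_i (A *m U^T) i j ^+ 2 &
        forall j i, l 0 j = 0 -> (A *m U^T) i j = 0].
Proof.
have [|U [l [UU AE]]] := @symmetric_spectral R q (A^T *m A).
  by rewrite trmx_mul trmxK.
have lE j : l 0 j = \sum_i (A *m U^T) i j ^+ 2.
  have : (A *m U^T)^T *m (A *m U^T) = diag_mx l.
    rewrite trmx_mul trmxK mulmxA -(mulmxA U) AE !mulmxA UU mul1mx.
    by rewrite -mulmxA UU mulmx1.
  move/matrixP => /(_ j j); rewrite [RHS]mxE eqxx mulr1n => <-.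
  by rewrite mxE; apply: eq_bigr => i _; rewrite [_^T _ _]mxE expr2.
exists U, l; split=> // j i; rewrite lE => /eqP.
rewrite psumr_eq0 => [/allP/(_ i (mem_index_enum _))|k _]; last exact: sqr_ge0.
by rewrite sqrf_eq0 => /eqP.
Qed.

End singular_values.

(** * The Frobenius inner product and the nuclear norm *)

Section frobenius.
Variable R : realType.
Implicit Types p q : nat.

Definition mxip p q (A B : 'M[R]_(p, q)) : R := \sum_i \sum_j A i j * B i j.

Lemma mxipC p q (A B : 'M[R]_(p, q)) : mxip A B = mxip B A.
Proof. by apply: eq_bigr => i _; apply: eq_bigr => j _; rewrite mulrC. Qed.

Lemma mxipDr p q (A B C : 'M[R]_(p, q)) : mxip A (B + C) = mxip A B + mxip A C.
Proof.
rewrite -big_split; apply: eq_bigr => i _; rewrite -big_split; apply: eq_bigr => j _.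
by rewrite mxE mulrDr.
Qed.

Lemma mxipZr p q a (A B : 'M[R]_(p, q)) : mxip A (a *: B) = a * mxip A B.
Proof.
rewrite mulr_sumr; apply: eq_bigr => i _; rewrite mulr_sumr; apply: eq_bigr => j _.
by rewrite mxE mulrCA.
Qed.

Lemma mxipNr p q (A B : 'M[R]_(p, q)) : mxip A (- B) = - mxip A B.
Proof. by rewrite -scaleN1r mxipZr mulN1r. Qed.

Lemma mxipDl p q (A B C : 'M[R]_(p, q)) : mxip (A + B) C = mxip A C + mxip B C.
Proof. by rewrite mxipC mxipDr !(mxipC C). Qed.

Lemma mxipZl p q a (A B : 'M[R]_(p, q)) : mxip (a *: A) B = a * mxip A B.
Proof. by rewrite mxipC mxipZr mxipC. Qed.

Lemma mxipNl p q (A B : 'M[R]_(p, q)) : mxip (- A) B = - mxip A B.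
Proof. by rewrite mxipC mxipNr mxipC. Qed.

Lemma mxip0r p q (A : 'M[R]_(p, q)) : mxip A 0 = 0.
Proof. by rewrite -(scale0r 0) mxipZr mul0r. Qed.

Lemma mxip_sumr (I : Type) (r : seq I) (P : pred I) p q (A : 'M[R]_(p, q)) B :
  mxip A (\sum_(i <- r | P i) B i) = \sum_(i <- r | P i) mxip A (B i).
Proof. by elim/big_ind2: _ => [|? ? ? ? <- <-|]; rewrite ?mxip0r ?mxipDr. Qed.

Lemma mxip_suml (I : Type) (r : seq I) (P : pred I) p q (A : 'M[R]_(p, q)) B :
  mxip (\sum_(i <- r | P i) B i) A = \sum_(i <- r | P i) mxip (B i) A.
Proof. by rewrite mxipC mxip_sumr; apply: eq_bigr => i _; rewrite mxipC. Qed.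

Lemma mxip_ge0 p q (A : 'M[R]_(p, q)) : 0 <= mxip A A.
Proof. by do 2 apply: sumr_ge0 => ? _; rewrite -expr2 sqr_ge0. Qed.

Lemma frobenius_normE p q (A : 'M[R]_(p, q)) : frobenius_norm A = Num.sqrt (mxip A A).
Proof.
by congr Num.sqrt; apply: eq_bigr => i _; apply: eq_bigr => j _; rewrite expr2.
Qed.

Lemma frobenius_norm_ge0 p q (A : 'M[R]_(p, q)) : 0 <= frobenius_norm A.
Proof. exact: sqrtr_ge0. Qed.

Lemma frobenius_norm_sqr p q (A : 'M[R]_(p, q)) : frobenius_norm A ^+ 2 = mxip A A.
Proof. by rewrite frobenius_normE sqr_sqrtr // mxip_ge0. Qed.

Lemma frobenius_norm_eq0 p q (A : 'M[R]_(p, q)) : frobenius_norm A = 0 -> A = 0.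
Proof.
move=> A0; have := frobenius_norm_sqr A; rewrite A0 expr0n /= => /esym/eqP.
rewrite psumr_eq0 => [/allP Ai|i _]; last first.
  by apply: sumr_ge0 => j _; rewrite -expr2 sqr_ge0.
apply/matrixP => i j; have := Ai i (mem_index_enum _) => /=.
rewrite psumr_eq0 => [/allP /(_ j (mem_index_enum _))|k _]; last first.
  by rewrite -expr2 sqr_ge0.
by rewrite mxE mulf_eq0 orbb => /eqP.
Qed.

(** Expanding [|bA - aB|^2 >= 0] with [a = |A|] and [b = |B|] gives [2ab(ab - <A, B>) >= 0]. Zero
    norms are treated first, so that [ab] can be cancelled. *)
Lemma cauchy_schwarz p q (A B : 'M[R]_(p, q)) :
  mxip A B <= frobenius_norm A * frobenius_norm B.
Proof.
have [/frobenius_norm_eq0 -> |A0] := eqVneq (frobenius_norm A) 0.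
  by rewrite mxipC mxip0r mulr_ge0 // frobenius_norm_ge0.
have [/frobenius_norm_eq0 -> |B0] := eqVneq (frobenius_norm B) 0.
  by rewrite mxip0r mulr_ge0 // frobenius_norm_ge0.
set a := frobenius_norm A in A0 *; set b := frobenius_norm B in B0 *.
have ab : 0 < a * b by rewrite mulr_gt0 // lt_def ?A0 ?B0 frobenius_norm_ge0.
have := mxip_ge0 (b *: A - a *: B).
rewrite !(mxipDl, mxipDr, mxipNl, mxipNr, mxipZl, mxipZr) (mxipC B).
rewrite -!frobenius_norm_sqr -/a -/b => h.
have : 0 <= (a * b) * (a * b - mxip A B) *+ 2.
  by apply: le_trans h _; rewrite le_eqVlt; apply/orP; left; apply/eqP; ring.
by rewrite pmulrn_lge0 // pmulr_rge0 // subr_ge0.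
Qed.

Lemma frobenius_normD p q (A B : 'M[R]_(p, q)) :
  frobenius_norm (A + B) <= frobenius_norm A + frobenius_norm B.
Proof.
rewrite -ler_sqr ?nnegrE ?addr_ge0 ?frobenius_norm_ge0 // sqrrD !frobenius_norm_sqr.
rewrite !(mxipDl, mxipDr) (mxipC B) addrA lerD2r -addrA lerD2l mulr2n.
by rewrite lerD // cauchy_schwarz.
Qed.

Lemma frobenius_normN p q (A : 'M[R]_(p, q)) : frobenius_norm (- A) = frobenius_norm A.
Proof. by rewrite !frobenius_normE mxipNl mxipNr opprK. Qed.

Lemma frobenius_normB p q (A B : 'M[R]_(p, q)) :
  frobenius_norm (A - B) <= frobenius_norm A + frobenius_norm B.
Proof. by rewrite -(frobenius_normN B) frobenius_normD. Qed.

Lemma frobenius_normZ p q a (A : 'M[R]_(p, q)) :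
  frobenius_norm (a *: A) = `|a| * frobenius_norm A.
Proof.
by rewrite !frobenius_normE mxipZl mxipZr mulrA -expr2 sqrtrM ?sqr_ge0 // sqrtr_sqr.
Qed.

Lemma mxip_trace p q (A B : 'M[R]_(p, q)) : mxip A B = \tr (A^T *m B).
Proof.
rewrite /mxip exchange_big /mxtrace; apply: eq_bigr => j _; rewrite mxE.
by apply: eq_bigr => i _; rewrite mxE.
Qed.

Lemma mxip_orthogonal p q (A B : 'M[R]_(p, q)) (U : 'M[R]_q) :
  U *m U^T = 1%:M -> mxip (A *m U^T) (B *m U^T) = mxip A B.
Proof.
move=> /mulmx1C UU; rewrite !mxip_trace trmx_mul trmxK mxtrace_mulC !mulmxA.
by rewrite -(mulmxA B) UU mulmx1 mxtrace_mulC.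
Qed.

End frobenius.

(** * Duality between the nuclear norm and contractions *)

Section nuclear.
Variable R : realType.
Implicit Types p q : nat.

(** Operator norm at most 1; these matrices form the dual unit ball of the nuclear norm. *)
Definition contraction p q (Z : 'M[R]_(p, q)) : Prop :=
  forall u : 'cV[R]_q, mxip (Z *m u) (Z *m u) <= mxip u u.

Lemma mxip_col p q (A B : 'M[R]_(p, q)) :
  mxip A B = \sum_j mxip (col j A) (col j B).
Proof.
rewrite /mxip exchange_big; apply: eq_bigr => j _; apply: eq_bigr => i _.
by rewrite big_ord1 !mxE.
Qed.

Lemma contraction_col_orthogonal p q (Z : 'M[R]_(p, q)) (U : 'M[R]_q) j :
  contraction Z -> U *m U^T = 1%:M -> frobenius_norm (col j (Z *m U^T)) <= 1.
Proof.
move=> cZ UU; rewrite frobenius_normE -[leRHS]sqrtr1 ler_wsqrtr //.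
rewrite colE -mulmxA; apply: le_trans (cZ _) _; rewrite mxip_trace.
rewrite trmx_mul trmxK mulmxA -(mulmxA _ U) UU mulmx1 trmx_delta mul_delta_mx.
by rewrite /mxtrace big_ord1 !mxE.
Qed.

Lemma nuclear_normE p q (A : 'M[R]_(p, q)) (U : 'M[R]_q) (l : 'rV[R]_q) :
  U *m U^T = 1%:M -> A^T *m A = U^T *m diag_mx l *m U ->
  nuclear_norm A = \sum_j Num.sqrt (l 0 j).
Proof.
move=> UU AE; rewrite /nuclear_norm (perm_big _ (singular_values_perm UU AE)) /=.
by rewrite big_map big_enum.
Qed.

Lemma nuclear_norm_ge0 p q (A : 'M[R]_(p, q)) : 0 <= nuclear_norm A.
Proof.
have [U [l [UU AE _ _]]] := gram_spectral A.
by rewrite (nuclear_normE UU AE) sumr_ge0 // => j _; exact: sqrtr_ge0.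
Qed.

(** In the basis of right singular vectors of [A], Cauchy-Schwarz applies column by column: column
    [j] of [A U^T] has norm [sqrt(l_j)], and that of [Z U^T] has norm at most 1. *)
Lemma contraction_mxip_le p q (Z A : 'M[R]_(p, q)) :
  contraction Z -> mxip Z A <= nuclear_norm A.
Proof.
move=> cZ; have [U [l [UU AE lE _]]] := gram_spectral A.
rewrite (nuclear_normE UU AE) -(mxip_orthogonal _ _ UU) mxip_col.
apply: ler_sum => j _; apply: le_trans (cauchy_schwarz _ _) _.
have -> : Num.sqrt (l 0 j) = frobenius_norm (col j (A *m U^T)).
  rewrite lE; congr Num.sqrt; apply: eq_bigr => i _.
  by rewrite big_ord1 [in RHS]mxE.
by rewrite ler_piMl ?frobenius_norm_ge0 // contraction_col_orthogonal.
Qed.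

(* With A = V diag(sigma) U, the witness Z is V U with zero singular values
   dropped. *)
Lemma nuclear_norm_dual p q (A : 'M[R]_(p, q)) :
  exists2 Z : 'M[R]_(p, q), contraction Z & nuclear_norm A = mxip Z A.
Proof.
have [U [l [UU AE lE _]]] := gram_spectral A.
have l_ge0 j : 0 <= l 0 j.
  by rewrite lE sumr_ge0 // => i _; exact: sqr_ge0.
(* The inverse of 0 is 0, which is what drops the zero singular values. *)
pose g := \row_j (Num.sqrt (l 0 j))^-1.
exists (A *m U^T *m diag_mx g *m U); last first.
  rewrite (nuclear_normE UU AE) -(mxip_orthogonal _ _ UU) -(mulmxA _ U) UU mulmx1.
  rewrite mxip_col; apply: eq_bigr => j _; rewrite {1}/mxip.
  have -> : Num.sqrt (l 0 j) = (Num.sqrt (l 0 j))^-1 * l 0 j.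
    have [l0|l0] := eqVneq (Num.sqrt (l 0 j)) 0; first by rewrite l0 invr0 mul0r.
    by rewrite -{3}(sqr_sqrtr (l_ge0 j)) expr2 mulKf.
  rewrite lE mulr_sumr; apply: eq_bigr => i _; rewrite big_ord1.
  rewrite mul_mx_diag [col j _ _ _]mxE [(\matrix_(_, _) _) _ _]mxE [g _ _]mxE -lE.
  by rewrite [col j _ _ _]mxE expr2 mulrAC mulrC.
move=> u; rewrite -!mulmxA; set y := U *m u.
have uy : mxip u u = \sum_j y j 0 ^+ 2.
  transitivity (mxip y y).
    by rewrite !mxip_trace trmx_mul mulmxA -(mulmxA _ U^T) (mulmx1C UU) mulmx1.
  by apply: eq_bigr => j _; rewrite big_ord1 expr2.
have D : (A *m U^T)^T *m (A *m U^T) = diag_mx l.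
  rewrite trmx_mul trmxK !mulmxA -(mulmxA U) AE !mulmxA UU mul1mx.
  by rewrite -mulmxA UU mulmx1.
rewrite (mulmxA A); set X := A *m U^T in D *; set z := diag_mx g *m y.
rewrite mxip_trace trmx_mul -(mulmxA z^T) (mulmxA X^T) D uy /z.
rewrite /mxtrace big_ord1 mxE; apply: ler_sum => j _.
rewrite !mul_diag_mx [_^T _ _]mxE ![(\matrix_(_, _) _) _ _]mxE.
have [l0|l0] := eqVneq (Num.sqrt (l 0 j)) 0.
  by rewrite l0 invr0 !mul0r sqr_ge0.
rewrite -{2}(sqr_sqrtr (l_ge0 j)) le_eqVlt; apply/orP; left; apply/eqP.
by field.
Qed.

(** Each of the [q] columns is the image of a unit vector, hence has norm at most 1. *)
Lemma contraction_norm p q (Z : 'M[R]_(p, q)) :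
  contraction Z -> frobenius_norm Z <= Num.sqrt q%:R.
Proof.
move=> cZ; rewrite frobenius_normE ler_wsqrtr // mxip_col.
rewrite -[in leRHS](card_ord q) -sumr_const; apply: ler_sum => j _.
rewrite -frobenius_norm_sqr expr_le1 ?frobenius_norm_ge0 //.
have := contraction_col_orthogonal j cZ (U := 1%:M).
by rewrite trmx1 !mulmx1 => /(_ erefl).
Qed.

(** A contraction attaining the nuclear norm of [A + B] is paired with [A] by duality and with [B]
    by Cauchy-Schwarz. This prices the nuclear penalty along a perturbation. *)
Lemma nuclear_norm_perturb p q (A B : 'M[R]_(p, q)) :
  nuclear_norm (A + B) <= nuclear_norm A + Num.sqrt q%:R * frobenius_norm B.
Proof.
have [Z cZ ->] := nuclear_norm_dual (A + B).
rewrite mxipDr lerD ?contraction_mxip_le //.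
apply: le_trans (cauchy_schwarz _ _) _.
by rewrite ler_wpM2r ?frobenius_norm_ge0 ?contraction_norm.
Qed.

End nuclear.

(** * The pseudo-inverse *)

Section sigma_min.
Variable R : realType.
Implicit Types p q : nat.

Lemma head_sort_le (t : seq R) x : x \in t -> head 0 (sort <=%R t) <= x.
Proof.
rewrite -(mem_sort <=%R); have := sort_sorted (@le_total _ R) t.
case: (sort _ t) => //= a s /(order_path_min le_trans) /allP s_ge.
by rewrite inE => /orP[/eqP ->//|/s_ge].
Qed.

Lemma sigma_min_le p q (A : 'M[R]_(p, q)) x :
  x \in singular_values A -> x != 0 -> sigma_min A <= x.
Proof. by move=> xA x0; rewrite head_sort_le // mem_filter x0. Qed.

Lemma singular_values_ge0 p q (A : 'M[R]_(p, q)) x : x \in singular_values A -> 0 <= x.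
Proof. by move=> /flatten_mapP[y _ /nseqP[-> _]]; exact: sqrtr_ge0. Qed.

Lemma sigma_min_ge0 p q (A : 'M[R]_(p, q)) : 0 <= sigma_min A.
Proof.
rewrite /sigma_min; set t := [seq _ <- _ | _].
have : {subset sort <=%R t <= singular_values A}.
  by move=> x; rewrite mem_sort mem_filter => /andP[].
by case: (sort _ t) => //= a s sub; apply: singular_values_ge0 (sub a (mem_head _ _)).
Qed.

Lemma sigma_min_gt0 p q (A : 'M[R]_(p, q)) : A != 0 -> 0 < sigma_min A.
Proof.
move=> A0; have [U [l [UU AE lE l0]]] := gram_spectral A.
have perm := singular_values_perm UU AE.
have [j lj0] : exists j, l 0 j != 0.
  apply/existsP; apply: contraNT A0; rewrite negb_exists => /forallP lz.
  have AU : A *m U^T = 0.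
    apply/matrixP => i j; rewrite [RHS]mxE; apply: l0.
    by apply/eqP; have := lz j; rewrite negbK.
  by rewrite -(mulmx1 A) -(mulmx1C UU) mulmxA AU mul0mx.
rewrite /sigma_min; set t := [seq _ <- _ | _].
have tj : Num.sqrt (l 0 j) \in t.
  rewrite mem_filter (perm_mem perm); apply/andP; split.
    rewrite sqrtr_eq0 -ltNge lt_def lj0 lE sumr_ge0 // => i _; exact: sqr_ge0.
  by apply/mapP; exists j => //; rewrite mem_enum.
have : {subset sort <=%R t <= t} by move=> x; rewrite mem_sort.
have : (0 < size (sort <=%R t))%N by rewrite size_sort; case: (t) tj.
case: (sort _ t) => //= a s _ sub; have := sub a (mem_head _ _).
by rewrite mem_filter => /andP[a0 /singular_values_ge0 a_ge]; rewrite lt_def a0.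
Qed.

(** The witness is [(B^T B)^+ B^T], where only nonzero eigenvalues are inverted. The first two
    clauses make [B Bp] the orthogonal projection onto the range of [B]; the squared row norms are
    the diagonal entries of [Bp Bp^T = (B^T B)^+], whose eigenvalues are at most [sigma_min^-2]. *)
Lemma pseudo_inverse p q (B : 'M[R]_(p, q)) :
  exists Bp : 'M[R]_(q, p),
    [/\ (B *m Bp)^T = B *m Bp, B^T *m (B *m Bp) = B^T &
        forall k, \sum_i Bp k i ^+ 2 <= (sigma_min B)^-1 ^+ 2].
Proof.
have [U [l [UU AE lE l0]]] := gram_spectral B.
have UU' := mulmx1C UU.
pose g := \row_j (l 0 j)^-1.
have D : (B *m U^T)^T *m (B *m U^T) = diag_mx l.
  rewrite trmx_mul trmxK !mulmxA -(mulmxA U) AE !mulmxA UU mul1mx.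
  by rewrite -mulmxA UU mulmx1.
exists (U^T *m diag_mx g *m U *m B^T); split.
- by rewrite !mulmxA !trmx_mul !trmxK tr_diag_mx !mulmxA.
- set X := B *m U^T in D *.
  have BX : B = X *m U by rewrite /X -mulmxA UU' mulmx1.
  (* The product of the two diagonal matrices is the identity except at zero eigenvalues, where the
     column of [X] vanishes. *)
  have XD : diag_mx l *m diag_mx g *m X^T = X^T.
    apply/matrixP => j i.
    rewrite mulmx_diag mul_diag_mx 2![(\matrix_(_, _) _) _ _]mxE ![(\row__ _) _ _]mxE.
    have [lj|lj] := eqVneq (l 0 j) 0; last by rewrite divff // mul1r.
    by rewrite lj mul0r mul0r mxE l0.
  rewrite BX trmx_mul !mulmxA -(mulmxA _ U U^T) UU mulmx1 -(mulmxA _ U U^T) UU mulmx1.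
  by rewrite -(mulmxA _ B) -/X -(mulmxA U^T) D -!mulmxA (mulmxA (diag_mx l)) XD.
move=> k; set Bp := _ *m B^T.
have gram : Bp *m Bp^T = U^T *m diag_mx g *m U.
  rewrite /Bp !trmx_mul !trmxK tr_diag_mx !mulmxA -(mulmxA _ B^T) AE !mulmxA.
  rewrite -(mulmxA _ U U^T) UU mulmx1 -(mulmxA _ U U^T) UU mulmx1.
  congr (_ *m U); rewrite -!mulmxA; congr (_ *m _).
  rewrite !mulmx_diag; congr diag_mx; apply/rowP => j; rewrite !mxE.
  have [lj|lj] := eqVneq (l 0 j) 0; last by rewrite mulfV // mulr1.
  by rewrite lj invr0 mul0r.
have -> : \sum_i Bp k i ^+ 2 = (Bp *m Bp^T) k k.
  by rewrite [RHS]mxE; apply: eq_bigr => i _; rewrite [_^T _ _]mxE expr2.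
rewrite gram -mulmxA mxE.
(* Each inverted eigenvalue is at most [sigma_min^-2], and column [k] of the orthogonal matrix [U]
   has norm 1. *)
apply: (@le_trans _ _ (\sum_j (sigma_min B)^-1 ^+ 2 * U j k ^+ 2)).
  apply: ler_sum => j _; rewrite [_^T _ _]mxE mul_diag_mx 2![(\matrix_(_, _) _) _ _]mxE.
  rewrite mulrCA -expr2 ler_wpM2r ?sqr_ge0 //.
  have [lj|lj] := eqVneq (l 0 j) 0; first by rewrite lj invr0 sqr_ge0.
  have lj_gt0 : 0 < l 0 j.
    by rewrite lt_def lj lE sumr_ge0 // => i _; exact: sqr_ge0.
  have B0 : B != 0.
    apply: contra_neq lj => B0; rewrite lE big1 // => i _.
    by rewrite B0 mul0mx mxE expr0n.
  rewrite exprVn lef_pV2 ?posrE ?exprn_gt0 ?sigma_min_gt0 //.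
  rewrite -[leRHS](sqr_sqrtr (ltW lj_gt0)) ler_sqr ?nnegrE ?sqrtr_ge0 ?sigma_min_ge0 //.
  apply: sigma_min_le; last by rewrite sqrtr_eq0 -ltNge.
  rewrite (perm_mem (singular_values_perm UU AE)).
  by apply/mapP; exists j => //; rewrite mem_enum.
rewrite -mulr_sumr -[leRHS]mulr1 ler_wpM2l ?sqr_ge0 //.
have /matrixP /(_ k k) := UU'; rewrite !mxE eqxx => E; rewrite -[leRHS]/(true%:R) -E.
by apply: ler_sum => j _; rewrite [_^T _ _]mxE expr2.
Qed.

End sigma_min.

(** * Connected components and the incidence matrix *)

Section components.
Variables (R : realType) (n : nat) (e : rel 'I_n).
Hypothesis e_sym : symmetric e.

Definition component_roots : {set 'I_n} := [set c in fingraph.roots e]%SET.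

(** For a root [c], the unit vector proportional to the indicator of the component of [c]. Over all
    roots these vectors form an orthonormal basis of the functions constant on components. *)
Definition component_vec (c i : 'I_n) : R :=
  (fingraph.root e i == c)%:R / Num.sqrt (\sum_j (fingraph.root e j == c)%:R).

Lemma card_component_roots : #|component_roots| = num_components e.
Proof. by apply: eq_card => c; rewrite !inE andbT. Qed.

Lemma component_size_gt0 (i : 'I_n) :
  0 < \sum_j (fingraph.root e j == fingraph.root e i)%:R :> R.
Proof. by rewrite (bigD1 i) //= eqxx ltr_pwDl // sumr_ge0. Qed.

Lemma component_vec_sum (i : 'I_n) :
  \sum_k component_vec (fingraph.root e i) k ^+ 2 = 1.
Proof.
have s0 := component_size_gt0 i; rewrite /component_vec.
set s := \sum_j _ in s0 *.
transitivity (\sum_k (fingraph.root e k == fingraph.root e i)%:R / s).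
  apply: eq_bigr => k _; rewrite exprMn exprVn sqr_sqrtr ?ltW //.
  by case: (_ == _); rewrite ?expr1n ?expr0n.
by rewrite -mulr_suml divff // gt_eqF.
Qed.

Lemma component_vec_orthonormal c c' : c \in component_roots ->
  \sum_i component_vec c i * component_vec c' i = (c == c')%:R.
Proof.
rewrite !inE => /eqP rc; have [<-|cc'] := eqVneq c c'.
  under eq_bigr do rewrite -expr2.
  by rewrite -rc component_vec_sum.
rewrite big1 // => i _; rewrite /component_vec.
have [->|_] := eqVneq (fingraph.root e i) c; last by rewrite !mul0r.
by rewrite (negbTE cc') mul0r mulr0.
Qed.

Let e_csym : connect_sym e.
Proof. exact: sym_connect_sym. Qed.

Lemma component_vec_edge c i j : e i j -> component_vec c i = component_vec c j.
Proof.
by move=> eij; rewrite /component_vec (fingraph.rootP e_csym (connect1 eij)).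
Qed.

(** A function constant along edges is constant on components, so it equals its orthogonal
    projection onto the component vectors; at [i] only the term of the root of [i] survives. *)
Lemma component_vec_expand (x : 'I_n -> R) i :
  (forall j k, e j k -> x j = x k) ->
  x i = \sum_(c in component_roots) component_vec c i * \sum_j component_vec c j * x j.
Proof.
move=> x_const.
have x_conn j k : connect e j k -> x j = x k.
  move=> /connectP[p]; elim: p j => [j _ -> //|l p IHp j /= /andP[ejl pl] kE].
  by rewrite (x_const _ _ ejl); exact: IHp.
have rootC : fingraph.root e i \in component_roots by rewrite inE; exact: (roots_root e_csym).
rewrite (bigD1 _ rootC) /= [X in _ + X]big1 ?addr0; last first.
  move=> c /andP[_ ci]; rewrite {1}/component_vec.
  by rewrite eq_sym (negbTE ci) !mul0r.
rewrite -[LHS]mul1r -(component_vec_sum i) mulr_suml mulr_sumr.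
apply: eq_bigr => j _; rewrite /component_vec eqxx.
have [rji|_] := eqVneq (fingraph.root e j) (fingraph.root e i); last first.
  by rewrite !mul0r !mulr0 expr0n mul0r.
rewrite expr2 -mulrA; congr (_ * (_ * _)); apply: x_conn.
by apply/(fingraph.rootP e_csym).
Qed.

(** Stated for values in any module because it is applied to scalars and to matrices. *)
Lemma incidence_sum (V : lmodType R) (f : 'I_n -> V) (l : 'I_#|edges e|) :
  \sum_j incidence_mx R e j l *: f j = f (enum_val l).1 - f (enum_val l).2.
Proof.
under eq_bigr do rewrite mxE scalerBl.
rewrite sumrB; congr (_ - _).
  rewrite (bigD1 (enum_val l).1) //= eqxx scale1r big1 ?addr0 // => j /negbTE ->.
  by rewrite scale0r.
rewrite (bigD1 (enum_val l).2) //= eqxx scale1r big1 ?addr0 // => j /negbTE ->.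
by rewrite scale0r.
Qed.

(** Put [W = 1 - B Bp]. As [B^T W = 0], the columns of [W] are constant along edges and equal their
    projections onto the component vectors; the coefficients are those of the identity, because [B]
    is annihilated from the left by component vectors. So [W] is the projection onto the functions
    constant on components. *)
Lemma identity_split : exists Bp : 'M[R]_(#|edges e|, n),
  (forall k, \sum_i Bp k i ^+ 2 <= (sigma_min (incidence_mx R e))^-1 ^+ 2) /\
  forall i j, (i == j)%:R = \sum_(c in component_roots) component_vec c i * component_vec c j
                  + \sum_l Bp l i * incidence_mx R e j l.
Proof.
set B := incidence_mx R e.
have [Bp [BBsym BBB Bple]] := pseudo_inverse B.
exists Bp; split=> // i j; pose W := 1%:M - B *m Bp.
have BW : B^T *m W = 0 by rewrite mulmxBr BBB mulmx1 subrr.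
have W_edge k i1 i2 : e i1 i2 -> W i1 k = W i2 k.
  (* Columns of [B] exist only for pairs with [i1 < i2]; symmetry of [e] handles the other
     orientation. *)
  wlog lt12 : i1 i2 / (i1 < i2)%N.
    move=> wl e12; case: (ltngtP i1 i2) => [lt|gt|/val_inj ->//].
      exact: wl.
    by rewrite (wl i2 i1) // e_sym.
  move=> e12; have pE : (i1, i2) \in edges e by rewrite inE lt12.
  have /matrixP /(_ (enum_rank_in pE (i1, i2)) k) := BW.
  rewrite [LHS]mxE [RHS]mxE; under eq_bigr do rewrite [_^T _ _]mxE.
  rewrite (incidence_sum (fun m => W m k : R^o)) enum_rankK_in //= => /eqP.
  by rewrite subr_eq0 => /eqP.
(* Component vectors take equal values at the ends of each edge, so their product with [B] is 0 and
   [W] fixes them. *)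
have yW c : \sum_k component_vec c k * W k j = component_vec c j.
  transitivity (((\row_k component_vec c k) *m W) 0 j).
    by rewrite !mxE; apply: eq_bigr => k _; rewrite [in RHS]mxE.
  have -> : (\row_k component_vec c k) *m W = \row_k component_vec c k.
    rewrite mulmxBr mulmx1 mulmxA [X in X *m _](_ : _ = 0) ?mul0mx ?subr0 //.
    apply/rowP => l; rewrite !mxE; under eq_bigr do rewrite mxE mulrC.
    rewrite (incidence_sum (fun m => component_vec c m : R^o)).
    apply/eqP; rewrite subr_eq0; apply/eqP; apply: component_vec_edge.
    by have := enum_valP l; rewrite inE => /andP[].
  by rewrite mxE.
have := component_vec_expand i (W_edge j).
under eq_bigr do rewrite yW.
have -> : W i j = (i == j)%:R - (B *m Bp) i j by rewrite !mxE.
move=> /eqP; rewrite subr_eq => /eqP ->; congr (_ + _).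
rewrite -BBsym !mxE; apply: eq_bigr => l _; exact: mulrC.
Qed.

End components.

(** * The deterministic inequality *)

Section deterministic.
Variables (R : realType) (n d1 d2 : nat) (e : rel 'I_n) (w : 'I_n -> 'I_n -> R).
Variables (gamma1 gamma2 : R) (M N X : 'I_n -> 'M[R]_(d1, d2)).
Variable Bp : 'M[R]_(#|edges e|, n).
Hypotheses (e_sym : symmetric e) (gamma1_ge0 : 0 <= gamma1) (gamma2_ge0 : 0 <= gamma2).
Hypothesis w_ge : forall i j : 'I_n, (i < j)%N -> e i j -> 2^-1 <= w i j.
Hypothesis Bp_split : forall i j, (i == j)%:R
  = \sum_(c in component_roots e) component_vec R e c i * component_vec R e c j
    + \sum_l Bp l i * incidence_mx R e j l.
Hypothesis X_opt :
  clustering_solution e w gamma1 gamma2 (fun i => M i + N i) X.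

Let C := component_roots e.
Let y := component_vec R e.

(** The matrix-valued coordinate of the noise along the component vector of [c]. *)
Definition component_noise (c : 'I_n) := \sum_j y c j *: N j.

Definition component_energy : R :=
  \sum_(c in C) frobenius_norm (component_noise c) ^+ 2.

(** [H] is the projection of the noise onto families constant on components, [G] is [Bp] applied to
    the noise, with one matrix per edge, and [D] is the estimation error. *)
Let H i := \sum_(c in C) y c i *: component_noise c.
Let G (l : 'I_#|edges e|) := \sum_i Bp l i *: N i.
Let D i := X i - M i.

(** The splitting of the identity is inserted between the noise and the error; the incidence matrix
    turns the error into its differences across edges. *)
Let noise_split : \sum_i mxip (N i) (D i) = \sum_i mxip (H i) (D i)
  + \sum_l mxip (G l) (D (enum_val l).1 - D (enum_val l).2).
Proof.
have -> : \sum_i mxip (N i) (D i) = \sum_i \sum_j (i == j)%:R * mxip (N i) (D j).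
  apply: eq_bigr => i _; rewrite (bigD1 i) //= eqxx mul1r big1 ?addr0 // => j.
  by rewrite eq_sym => /negbTE ->; rewrite mul0r.
under eq_bigr do under eq_bigr do rewrite Bp_split mulrDl.
under eq_bigr do rewrite big_split /=.
rewrite big_split /=; congr (_ + _).
  rewrite exchange_big; apply: eq_bigr => j _ /=.
  rewrite /H mxip_suml; under eq_bigr do rewrite mulr_suml.
  rewrite exchange_big; apply: eq_bigr => c _ /=.
  rewrite mxipZl /component_noise mxip_suml mulr_sumr; apply: eq_bigr => i _.
  by rewrite mxipZl -[component_vec R e c i]/(y c i) -[component_vec R e c j]/(y c j); ring.
under eq_bigr do under eq_bigr do rewrite mulr_suml.
under eq_bigr do rewrite exchange_big.
rewrite exchange_big; apply: eq_bigr => l _ /=.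
rewrite -incidence_sum mxip_suml; apply: eq_bigr => i _.
rewrite mxipZl mxip_sumr mulr_sumr; apply: eq_bigr => j _.
by rewrite mxipZr mulrA.
Qed.

(** This and the next identity express that [H] is an orthogonal projection of [N]: its pairing with
    [N] is its own squared norm. *)
Let HN : \sum_i mxip (H i) (N i) = component_energy.
Proof.
under eq_bigr do rewrite mxip_suml.
rewrite exchange_big; apply: eq_bigr => c _ /=.
rewrite frobenius_norm_sqr {3}/component_noise mxip_sumr; apply: eq_bigr => i _.
by rewrite mxipZl mxipZr.
Qed.

Let HH : \sum_i mxip (H i) (H i) = component_energy.
Proof.
under eq_bigr do rewrite mxip_suml.
rewrite exchange_big; apply: eq_bigr => c cC /=.
under eq_bigr do rewrite mxip_sumr.
rewrite exchange_big (bigD1 c) //= [X in _ + X]big1 ?addr0; last first.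
  move=> c' /andP[_ cc']; under eq_bigr do rewrite mxipZl mxipZr mulrA.
  by rewrite -mulr_suml component_vec_orthonormal // eq_sym (negbTE cc') mul0r.
under eq_bigr do rewrite mxipZl mxipZr mulrA.
by rewrite -mulr_suml component_vec_orthonormal // eqxx mul1r frobenius_norm_sqr.
Qed.

Let DN_norm i : frobenius_norm (X i - (M i + N i)) ^+ 2
  = mxip (D i) (D i) - mxip (N i) (D i) *+ 2 + mxip (N i) (N i).
Proof.
rewrite opprD addrA -/(D i) frobenius_norm_sqr.
move: (D i) => Di; rewrite !(mxipDl, mxipDr, mxipNl, mxipNr) (mxipC Di).
by rewrite mulr2n; ring.
Qed.

(** Cauchy-Schwarz between the all-ones vector and the vector of norms. *)
Lemma frobenius_sum_le (F : 'I_n -> 'M[R]_(d1, d2)) :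
  \sum_i frobenius_norm (F i) <= Num.sqrt n%:R * Num.sqrt (\sum_i mxip (F i) (F i)).
Proof.
pose u : 'rV[R]_n := \row_i frobenius_norm (F i).
have uE : mxip u u = \sum_i mxip (F i) (F i).
  rewrite /mxip big_ord1; apply: eq_bigr => i _.
  by rewrite mxE -expr2 frobenius_norm_sqr.
have := cauchy_schwarz (const_mx 1) u.
rewrite !frobenius_normE uE {1 2}/mxip !big_ord1.
under eq_bigr do rewrite !mxE mul1r.
by under [in leRHS]eq_bigr do rewrite !mxE mul1r; rewrite sumr_const card_ord.
Qed.

(* First-order optimality of X in the direction - H. *)
Let opt_perturb : \sum_i mxip (H i) (D i) <=
  component_energy + gamma2 * Num.sqrt d2%:R * \sum_i frobenius_norm (H i).
Proof.
apply/ler_addgt0Pr => eps eps0.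
set K := component_energy.
have K_ge0 : 0 <= K by rewrite sumr_ge0 // => c _; exact: sqr_ge0.
(* With this step length the second-order term [t^2 K] is at most [t eps]; adding 1 keeps the
   denominator positive when [K = 0]. *)
pose t := eps / (K + 1).
have t0 : 0 < t by rewrite divr_gt0 // ltr_wpDl.
have := X_opt (fun i => X i + (- t) *: H i).
rewrite /clustering_objective.
have -> : \sum_i frobenius_norm (X i + - t *: H i - (M i + N i)) ^+ 2
  = \sum_i frobenius_norm (X i - (M i + N i)) ^+ 2
    - (t * (\sum_i mxip (H i) (D i) - K)) *+ 2 + t ^+ 2 * K.
  transitivity (\sum_i (frobenius_norm (X i - (M i + N i)) ^+ 2
      - (t * (mxip (H i) (D i) - mxip (H i) (N i))) *+ 2 + t ^+ 2 * mxip (H i) (H i))).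
    2: by rewrite big_split sumrB sumrMnl -mulr_sumr sumrB HN -mulr_sumr HH.
  apply: eq_bigr => i _; rewrite [in RHS]DN_norm.
  have -> : X i + - t *: H i - (M i + N i) = D i - N i - t *: H i.
    by rewrite /D scaleNr opprD addrAC !addrA.
  move: (D i) (H i) => Di Hi.
  rewrite frobenius_norm_sqr !(mxipDl, mxipDr, mxipNl, mxipNr, mxipZl, mxipZr).
  rewrite (mxipC Di Hi) (mxipC (N i) Hi) (mxipC Di (N i)) /=.
  by rewrite !mulr2n; ring.
(* The fusion penalty does not change, as [H] is constant along edges. *)
have -> : \sum_(p in edges e)
      w p.1 p.2 * frobenius_norm (X p.1 + - t *: H p.1 - (X p.2 + - t *: H p.2))
  = \sum_(p in edges e) w p.1 p.2 * frobenius_norm (X p.1 - X p.2).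
  apply: eq_bigr => p; rewrite inE => /andP[_ ep].
  have -> : H p.1 = H p.2.
    by apply: eq_bigr => c _; rewrite /y (component_vec_edge _ e_sym _ ep).
  by rewrite opprD addrACA subrr addr0.
have : \sum_i nuclear_norm (X i + - t *: H i) <=
    \sum_i nuclear_norm (X i) + t * Num.sqrt d2%:R * \sum_i frobenius_norm (H i).
  rewrite mulr_sumr -big_split; apply: ler_sum => i _ /=.
  apply: le_trans (nuclear_norm_perturb _ _) _; rewrite lerD2l frobenius_normZ.
  by rewrite normrN gtr0_norm // mulrA (mulrC t).
move=> /(ler_wpM2l gamma2_ge0).
set s1 := \sum_i nuclear_norm _; set s2 := \sum_i nuclear_norm (X _).
set s3 := \sum_i frobenius_norm (H _); set s4 := \sum_i frobenius_norm _ ^+ 2.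
set s5 := \sum_(p in _) _; set a := \sum_i mxip _ _ => h1 h2.
have : t * (a - K) <= t * (gamma2 * Num.sqrt d2%:R * s3 + eps).
  have tK : t ^+ 2 * K <= t * eps.
    rewrite expr2 -mulrA ler_pM2l // /t mulrAC ler_pdivrMr ?ltr_wpDl //.
    by rewrite ler_pM2l // lerDl.
  have teps : 0 <= t * eps by rewrite mulr_ge0 // ltW.
  move: h1 h2 tK teps; move: (Num.sqrt _) => q; clearbody s1 s2 s3 s4 s5 a t K.
  by move=> *; lra.
by rewrite ler_pM2l // lerBlDr addrC addrA.
Qed.

(** The objective at [X] is compared with that at [M], and [noise_split] divides the noise term: the
    edge part goes into the fusion penalty, and the component part is bounded by [opt_perturb]. *)
Lemma clustering_error_bound :
  (forall l, frobenius_norm (\sum_i Bp l i *: N i) <= gamma1 / 2) ->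
  2^-1 * \sum_i frobenius_norm (X i - M i) ^+ 2 <=
    component_energy
    + gamma2 * Num.sqrt d2%:R * (Num.sqrt n%:R * Num.sqrt component_energy)
    + gamma1 / 2 * \sum_(p in edges e) (1 + 2 * w p.1 p.2) * frobenius_norm (M p.1 - M p.2)
    + gamma2 * \sum_i nuclear_norm (M i).
Proof.
move=> G_le.
have h := X_opt M; rewrite /clustering_objective in h.
have E1 : \sum_i frobenius_norm (X i - (M i + N i)) ^+ 2
  = \sum_i frobenius_norm (X i - M i) ^+ 2 - (\sum_i mxip (N i) (D i)) *+ 2
    + \sum_i frobenius_norm (N i) ^+ 2.
  rewrite -sumrMnl -sumrB -big_split; apply: eq_bigr => i _ /=.
  by rewrite DN_norm !frobenius_norm_sqr.
have E2 : \sum_i frobenius_norm (M i - (M i + N i)) ^+ 2 = \sum_i frobenius_norm (N i) ^+ 2.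
  by apply: eq_bigr => i _; rewrite opprD addrA subrr sub0r frobenius_normN.
rewrite E1 E2 noise_split in h.
have h1 := opt_perturb.
have h2 : gamma2 * Num.sqrt d2%:R * \sum_i frobenius_norm (H i) <=
    gamma2 * Num.sqrt d2%:R * (Num.sqrt n%:R * Num.sqrt component_energy).
  by rewrite ler_wpM2l ?mulr_ge0 ?sqrtr_ge0 // -HH frobenius_sum_le.
have h3 : 0 <= gamma2 * \sum_i nuclear_norm (X i).
  by rewrite mulr_ge0 // sumr_ge0 // => i _; exact: nuclear_norm_ge0.
have h4 : \sum_l mxip (G l) (D (enum_val l).1 - D (enum_val l).2)
    <= \sum_(p in edges e) gamma1 / 2 *
       (frobenius_norm (X p.1 - X p.2) + frobenius_norm (M p.1 - M p.2)).
  rewrite [leRHS]big_enum_val; apply: ler_sum => l _.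
  apply: le_trans (cauchy_schwarz _ _) _; apply: ler_pM; rewrite ?frobenius_norm_ge0 ?G_le //.
  rewrite /D opprD addrACA -opprD.
  exact: frobenius_normB.
(* Since [w >= 1/2], the weight [gamma1 / 2] on [|X_i - X_j|] is at most [gamma1 w]. On
   [|M_i - M_j|] the weights [gamma1 / 2] and [gamma1 w] add up to [gamma1 / 2] times [1 + 2w]. *)
have h5 : \sum_(p in edges e) gamma1 / 2 *
       (frobenius_norm (X p.1 - X p.2) + frobenius_norm (M p.1 - M p.2))
   + gamma1 * (\sum_(p in edges e) w p.1 p.2 * frobenius_norm (M p.1 - M p.2))
   <= gamma1 / 2 * (\sum_(p in edges e) (1 + 2 * w p.1 p.2) * frobenius_norm (M p.1 - M p.2))
   + gamma1 * (\sum_(p in edges e) w p.1 p.2 * frobenius_norm (X p.1 - X p.2)).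
  rewrite !mulr_sumr -!big_split; apply: ler_sum => p; rewrite inE => /andP[p12 ep] /=.
  have wX : 2^-1 * frobenius_norm (X p.1 - X p.2) <= w p.1 p.2 * frobenius_norm (X p.1 - X p.2).
    by rewrite ler_wpM2r ?frobenius_norm_ge0 // w_ge.
  have := ler_wpM2l gamma1_ge0 wX; nra.
lra.
Qed.

End deterministic.

(** * Independence and integrals of products *)

Section weighted_change_of_variables.
Context d d' (T : measurableType d) (T' : measurableType d') (R : realType).
Variables (mu : {measure set T -> \bar R}) (nu : {measure set T' -> \bar R}).
Variables (g : T -> R) (X : T -> T') (c : R).
Hypotheses (mg : measurable_fun setT g) (mX : measurable_fun setT X).
Hypothesis g_ge0 : forall x, 0 <= g x.
Hypothesis gX : forall V : set T', measurable V ->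
  (\int[mu]_x (g x * \1_V (X x))%:E = c%:E * nu V)%E.

Import HBNNSimple.

Let weighted_nnsfun (h : {nnsfun T' >-> R}) :
  (\int[mu]_x (g x * h (X x))%:E = c%:E * \int[nu]_y (h y)%:E)%E.
Proof.
have mh (r : R) : measurable (h @^-1` [set r]) by exact: measurable_funPTI.
have m1 (r : R) : measurable_fun setT (fun x => \1_(h @^-1` [set r]) (X x) : R).
  by apply: (@measurableT_comp _ _ _ _ _ _ (\1_(h @^-1` [set r]) : T' -> R) _ X) => //; exact: measurable_indic.
under [in RHS]eq_integral do rewrite fimfunE -fsumEFin//.
rewrite ge0_integral_fsum //; last 2 first.
- by move=> r; apply/measurable_EFinP; apply: measurable_funM => //; exact: measurable_indic.
- by move=> r y _; rewrite nnfun_muleindic_ge0.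
under eq_integral => x _.
  rewrite fimfunE EFinM -fsumEFin // ge0_mule_fsumr; last first.
    by move=> r; rewrite EFinM nnfun_muleindic_ge0.
  over.
rewrite ge0_integral_fsum //; last 2 first.
- move=> r; rewrite (_ : (fun x => _) = EFin \o (fun x => g x * (r * \1_(h @^-1` [set r]) (X x)))) //.
  by apply/measurable_EFinP; apply: measurable_funM => //; exact: measurable_funM.
- by move=> r x _; rewrite mule_ge0 ?lee_fin // -lee_fin nnfun_muleindic_ge0.
rewrite ge0_mule_fsumr; last first.
  by move=> r; apply: integral_ge0 => y _; rewrite nnfun_muleindic_ge0.
apply: eq_fsbigr => r /[!inE] -[y _ hy].
have r0 : 0 <= r by rewrite -hy.
have := gX (mh r).
transitivity (\int[mu]_x (r%:E * (g x * \1_(h @^-1` [set r]) (X x))%:E))%E.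
  by apply: eq_integral => x _; rewrite -!EFinM mulrCA.
rewrite ge0_integralZl //; last 2 first.
- by apply/measurable_EFinP; exact: measurable_funM.
- by move=> x _; rewrite lee_fin mulr_ge0.
rewrite gX // muleCA; congr (_ * _)%E.
rewrite integralZl_indic_nnsfun // integral_indic // setIT //.
Qed.

(** By [gX], the image under [X] of the measure with density [g] is [c nu]; simple functions and
    monotone convergence extend this to nonnegative functions. It serves for densities ([X] the
    identity), for laws ([g = 1]), and for independence ([g] a product of other factors). *)
Lemma ge0_integral_weighted_comp (f : T' -> R) :
  measurable_fun setT f -> (forall y, 0 <= f y) ->
  (\int[mu]_x (g x * f (X x))%:E = c%:E * \int[nu]_y (f y)%:E)%E.
Proof.
move=> mf f0.
have mEf : measurable_fun setT (EFin \o f) by exact/measurable_EFinP.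
pose f_ := nnsfun_approx measurableT mEf.
have f_cvg y : ((f_ n y)%:E @[n --> \oo] --> (f y)%:E)%E.
  by apply: (cvg_nnsfun_approx _ mEf) => // *; rewrite lee_fin.
have f_nd y : {homo (fun n => (f_ n y)) : a b / (a <= b)%N >-> a <= b}.
  by move=> a b ab; exact/lefP/nd_nnsfun_approx.
transitivity (limn (fun n => \int[mu]_x (g x * f_ n (X x))%:E))%E.
  rewrite -monotone_convergence //=.
  - apply: eq_integral => x _; apply/esym/cvg_lim => //.
    rewrite EFinM; under eq_fun do rewrite EFinM.
    exact: cvgeZl.
  - move=> n; apply/measurable_EFinP; apply: measurable_funM => //.
    exact: measurableT_comp.
  - by move=> n x _; rewrite lee_fin mulr_ge0.
  - by move=> x _ a b ab; rewrite lee_fin ler_wpM2l // f_nd.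
rewrite (_ : (\int[nu]_y (f y)%:E = limn (fun n => \int[nu]_y (f_ n y)%:E))%E); last first.
  rewrite -monotone_convergence //=.
  - by apply: eq_integral => x _; apply/esym/cvg_lim.
  - by move=> n; apply/measurable_EFinP.
  - by move=> n x _; rewrite lee_fin.
  - by move=> x _ a b ab; rewrite lee_fin f_nd.
rewrite -limeMl //.
  by congr (limn _); apply/funext => n /=; rewrite weighted_nnsfun.
apply/ereal_nondecreasing_is_cvgn => a b ab; apply: ge0_le_integral => //.
- by move=> x _; rewrite lee_fin.
- exact/measurable_EFinP.
- exact/measurable_EFinP.
- by move=> x _; rewrite lee_fin f_nd.
Qed.

End weighted_change_of_variables.

Section independence.
Context d (T : measurableType d) (R : realType) (P : probability T R).
Variables (I : finType) (X : I -> {RV P >-> R}).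
Hypothesis X_indep : mutually_independent X.

(* One index at a time, an indicator is replaced by a general function. *)
Let integral_prod_seq (s : seq I) (h : I -> R -> R) (c : I -> R) :
  (forall i, measurable_fun setT (h i)) -> (forall i x, 0 <= h i x) ->
  (forall i, \int[P]_w (h i (X i w))%:E = (c i)%:E)%E ->
  (forall i, i \notin s -> exists2 V, measurable V & h i = \1_V) ->
  (\int[P]_w (\prod_i h i (X i w))%:E = (\prod_i c i)%:E)%E.
Proof.
elim: s h c => [|k s IHs] h c mh h0 hc hs.
  (* When every factor is an indicator, the product is the indicator of an intersection and the
     claim is independence for the full index set. *)
  have /boolp.choice[V VP] i : exists V, measurable V /\ h i = \1_V.
    by have [|V mV hV] := hs i; rewrite ?in_nil //; exists V.
  have mXV i : measurable (X i @^-1` V i).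
    by have [mV _] := VP i; exact: measurable_funPTI.
  have hE i w : h i (X i w) = \1_(X i @^-1` V i) w by have [_ ->] := VP i.
  have cE i : (c i)%:E = P (X i @^-1` V i).
    rewrite -hc; under eq_integral do rewrite hE.
    by rewrite integral_indic // setIT.
  have := X_indep [set: I]%SET (fun i => (VP i).1).
  under [in RHS]eq_bigr do rewrite -cE.
  rewrite -prodEFin; under eq_bigl do rewrite finset.in_setT.
  move=> <-; rewrite -[X in _ = P X]setIT -integral_indic //; last first.
    by apply: fin_bigcap_measurable => [|i _]; [exact: finite_finset|exact: mXV].
  apply: eq_integral => w _; congr (_%:E); under eq_bigr do rewrite hE.
  have [wV|] := pselect (forall i, (X i @^-1` V i) w).
    rewrite [RHS]indicE mem_set // big1 // => i _.
    by rewrite indicE mem_set.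
  move=> /existsNP[i wi]; rewrite [RHS]indicE memNset; last first.
    by move=> /(_ i); apply: contra_not wi; apply; rewrite /= finset.in_setT.
  by rewrite (bigD1 i) //= indicE memNset // mul0r.
(* The factor of [k] is isolated. By the weighted change of variables it suffices to treat an
   indicator in its place. *)
pose g w := \prod_(i | i != k) h i (X i w).
pose C := \prod_(i | i != k) c i.
have c0 i : 0 <= c i.
  by rewrite -lee_fin -hc integral_ge0 // => w _; rewrite lee_fin.
have mg : measurable_fun setT g.
  rewrite (_ : g = fun w => \prod_i (if i != k then h i (X i w) else 1)); last first.
    by apply/funext => w; exact: big_mkcond.
  apply: measurable_prod => i _; case: (i != k) => //.
  exact: measurableT_comp.
transitivity (\int[P]_w (g w * h k (X k w))%:E)%E.
  by apply: eq_integral => w _; rewrite (bigD1 k) //= mulrC.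
rewrite (@ge0_integral_weighted_comp _ _ _ _ _ P (distribution P (X k)) g (X k) C) //.
- rewrite ge0_integral_distribution //; last 2 first.
  + by apply/measurable_EFinP.
  + by move=> y; rewrite lee_fin.
  by rewrite hc -EFinM (bigD1 k) //= mulrC.
- by move=> w; rewrite /g prodr_ge0.
move=> V mV.
(* With the indicator of [V] at [k], only the indices of [s] carry general functions, so the
   induction hypothesis applies. *)
pose h' i := if i == k then \1_V else h i.
pose c' i := if i == k then fine (P (X k @^-1` V)) else c i.
have mXV : measurable (X k @^-1` V) by exact: measurable_funPTI.
have IH : (\int[P]_w (\prod_i h' i (X i w))%:E = (\prod_i c' i)%:E)%E.
  apply: IHs => i.
  - by rewrite /h'; case: ifP => // _; exact: measurable_indic.
  - by rewrite /h'; case: ifP => // _ x.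
  - rewrite /h' /c'; case: eqP => [->|_] //.
    rewrite fineK ?fin_num_measure // -[in RHS](setIT (X k @^-1` V)).
    by rewrite -integral_indic //; apply: eq_integral => w _; rewrite !indicE.
  - rewrite /h'; case: eqP => [_ _|/eqP ik ins]; first by exists V.
    by apply: hs; rewrite in_cons negb_or ik.
rewrite [X in (_ * X)%E](_ : _ = (fine (P (X k @^-1` V)))%:E); last first.
  by rewrite fineK ?fin_num_measure.
transitivity (\int[P]_w (\prod_i h' i (X i w))%:E)%E.
  apply: eq_integral => w _; rewrite (bigD1 k) //= /h' eqxx mulrC; congr (_ * _)%:E.
  by apply: eq_bigr => i /negbTE ->.
rewrite IH -EFinM (bigD1 k) //= /c' eqxx mulrC; congr (_ * _)%:E.
by apply: eq_bigr => i /negbTE ->.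
Qed.

Lemma independent_integral_prod (h : I -> R -> R) (c : I -> R) :
  (forall i, measurable_fun setT (h i)) -> (forall i x, 0 <= h i x) ->
  (forall i, \int[P]_w (h i (X i w))%:E = (c i)%:E)%E ->
  (\int[P]_w (\prod_i h i (X i w))%:E = (\prod_i c i)%:E)%E.
Proof.
move=> mh h0 hc; apply: (integral_prod_seq (s := enum I)) => // i.
by rewrite mem_enum.
Qed.

End independence.

(** * Gaussian moments and tails *)

Section normal_moments.
Variable R : realType.
Local Notation mu := (@lebesgue_measure R).

Lemma integral_normal_prob (m s : R) (f : measurableTypeR R -> R) :
  measurable_fun setT f -> (forall y, 0 <= f y) ->
  (\int[normal_prob m s]_y (f y)%:E = \int[mu]_x (normal_pdf m s x * f x)%:E)%E.
Proof.
move=> mf f0.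
rewrite (@ge0_integral_weighted_comp _ _ _ _ _ mu (normal_prob m s) (normal_pdf m s) id 1) //.
- by rewrite mul1e.
- exact: (measurable_normal_pdf).
- by move=> x; exact: normal_pdf_ge0.
move=> V mV; rewrite mul1e [RHS]integral_mkcond.
apply: eq_integral => x _ /=; rewrite patchE indicE.
by case: ifP => _; rewrite ?mulr1 ?mulr0.
Qed.

(** Completing the square turns the integrand into a constant times the normal density with mean
    [b s^2]. *)
Lemma normal_mgf (s b : R) : s != 0 ->
  (\int[normal_prob 0 s]_y (expR (b * y))%:E = (expR (s ^+ 2 * b ^+ 2 / 2))%:E)%E.
Proof.
move=> s0; rewrite integral_normal_prob; last 2 first.
- by apply: measurableT_comp => //; exact: measurable_funM.
- by move=> y; exact: expR_ge0.
transitivity (\int[mu]_x ((expR (s ^+ 2 * b ^+ 2 / 2))%:E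
    * (normal_pdf (b * s ^+ 2) s x)%:E))%E.
  apply: eq_integral => x _; rewrite -EFinM !normal_pdfE // mulrCA -[X in X%:E = _]mulrA.
  congr (_ * _)%:E; rewrite /normal_fun -!expRD; congr expR.
  by field.
rewrite ge0_integralZl ?lee_fin ?expR_ge0 //.
- by rewrite integral_normal_pdf mule1.
- by apply/measurable_EFinP; exact: (measurable_normal_pdf).
- by move=> x _; rewrite lee_fin normal_pdf_ge0.
Qed.

(** The integrand is [t] times the centered normal density with standard deviation
    [t = (1 - 2a)^(-1/2)]. *)
Lemma normal_square_mgf (a : R) : a < 2^-1 ->
  (\int[normal_prob 0 1]_y (expR (a * y ^+ 2))%:E
     = ((Num.sqrt (1 - 2 * a))^-1)%:E)%E.
Proof.
move=> a2; have a_gt0 : 0 < 1 - 2 * a by lra.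
rewrite integral_normal_prob; last 2 first.
- apply: measurableT_comp => //; apply: measurable_funM => //.
- by move=> y; exact: expR_ge0.
set t := (Num.sqrt (1 - 2 * a))^-1.
have t_gt0 : 0 < t by rewrite invr_gt0 sqrtr_gt0.
have t2 : t ^+ 2 = (1 - 2 * a)^-1 by rewrite exprVn sqr_sqrtr // ltW.
have peak : normal_peak 1 = t * normal_peak t.
  rewrite /normal_peak expr1n mul1r -mulrnAr sqrtrM ?sqr_ge0 // sqrtr_sqr.
  by rewrite gtr0_norm // invfM mulrA divff ?mul1r // gt_eqF.
transitivity (\int[mu]_x (t%:E * (normal_pdf 0 t x)%:E))%E.
  apply: eq_integral => x _; rewrite -EFinM !normal_pdfE ?oner_eq0 ?gt_eqF //.
  rewrite peak -!mulrA; congr (_ * (_ * _))%:E.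
  rewrite /normal_fun -expRD; congr expR; rewrite t2 expr1n.
  by field; rewrite gt_eqF.
rewrite ge0_integralZl ?lee_fin ?(ltW t_gt0) //.
- by rewrite integral_normal_pdf mule1.
- by apply/measurable_EFinP; exact: (measurable_normal_pdf).
- by move=> x _; rewrite lee_fin normal_pdf_ge0.
Qed.

End normal_moments.

(** * Exponential Markov inequality *)

Section chernoff.
Context d (T : measurableType d) (R : realType) (P : probability T R).

Lemma measurable_superlevel (Y : T -> R) (t : R) :
  measurable_fun setT Y -> measurable [set w | t <= Y w].
Proof.
move=> mY; rewrite -[X in measurable X]setTI.
exact: (@measurable_fun_le _ _ _ _ (cst t) Y).
Qed.

(** The indicator of [t <= Y] is at most [exp(-at) exp(aY)]. *)
Lemma chernoff_le (Y : T -> R) (a t K : R) : measurable_fun setT Y -> 0 <= a ->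
  (\int[P]_w (expR (a * Y w))%:E = K%:E)%E ->
  (P [set w | t <= Y w]%R <= (expR (- (a * t)) * K)%:E)%E.
Proof.
move=> mY a0 KE.
have mA := measurable_superlevel t mY.
have mexp : measurable_fun setT (fun w => expR (a * Y w)).
  by apply: measurableT_comp => //; exact: measurable_funM.
rewrite -[X in P X]setIT -integral_indic // EFinM -KE -ge0_integralZl //; last exact/measurable_EFinP.
apply: ge0_le_integral => //.
- by apply/measurable_EFinP; exact: measurable_indic.
- by apply/measurable_EFinP; apply: measurable_funM.
move=> w _; rewrite -EFinM lee_fin indicE -expRD.
case: (boolP (w \in _)) => [|_]; last exact: expR_ge0.
rewrite inE /= => tY; rewrite -[leLHS]expR0 ler_expR addrC subr_ge0.
by rewrite ler_wpM2l.
Qed.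

End chernoff.

(** * Linear and quadratic forms in a Gaussian vector *)

Section gaussian_vector.
Context d (T : measurableType d) (R : realType) (P : probability T R).
Variables (I : finType) (sigma : R) (X : I -> {RV P >-> R}).
Hypotheses (sigma_gt0 : 0 < sigma) (X_iid : iid_gaussian sigma X).

Definition linear_form (b : I -> R) (w : T) : R := \sum_i b i * X i w.

Lemma measurable_linear_form b : measurable_fun setT (linear_form b).
Proof. by apply: measurable_sum => i; exact: measurable_funM. Qed.

Lemma linear_form_mgf (b : I -> R) :
  (\int[P]_w (expR (linear_form b w))%:E
     = (expR (sigma ^+ 2 / 2 * \sum_i b i ^+ 2))%:E)%E.
Proof.
have [X_indep X_normal] := X_iid.
transitivity (\int[P]_w (\prod_i expR (b i * X i w))%:E)%E.
  by apply: eq_integral => w _; rewrite expR_sum.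
rewrite (independent_integral_prod X_indep (h := fun i x => expR (b i * x))
  (c := fun i => expR (sigma ^+ 2 * b i ^+ 2 / 2))).
- rewrite -expR_sum; congr (expR _)%:E; rewrite mulr_sumr.
  by apply: eq_bigr => i _; rewrite mulrAC.
- by move=> i; apply: measurableT_comp => //; exact: measurable_funM.
- by move=> i x; exact: expR_ge0.
move=> i; rewrite -normal_mgf ?gt_eqF //.
pose f := fun x : measurableTypeR R => expR (b i * x).
have mf : measurable_fun setT f by apply: measurableT_comp => //; exact: measurable_funM.
have mX : measurable_fun setT (X i : T -> measurableTypeR R) by exact: (measurable_funPT (X i)).
(* The law of [X i] is given on Borel sets; this is the form that the change of variables with
   weight 1 takes as input. *)
have XN (V : set (measurableTypeR R)) : measurable V ->
    (\int[P]_w (1 * \1_V (X i w))%:E = 1%:E * normal_prob 0 sigma V)%E.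
  move=> mV; rewrite mul1e; transitivity (P (X i @^-1` V)); last exact: (X_normal i).
  rewrite -[in RHS](setIT (X i @^-1` V)) -integral_indic //; last exact: measurable_funPTI.
  by apply: eq_integral => w _; rewrite mul1r !indicE.
have f0 y : 0 <= f y by exact: expR_ge0.
have := @ge0_integral_weighted_comp _ _ T (measurableTypeR R) R P (normal_prob 0 sigma)
  (cst 1) (X i) 1 (measurable_cst _) mX (fun=> ler01) XN f mf f0.
by rewrite mul1e => <-; apply: eq_integral => w _; rewrite mul1r.
Qed.

(** The choice [a = t / v] minimizes the Chernoff exponent [a^2 v / 2 - a t]. *)
Lemma linear_form_tail (b : I -> R) (v t : R) : 0 < v -> 0 <= t ->
  sigma ^+ 2 * \sum_i b i ^+ 2 <= v ->
  (P [set w | t <= linear_form b w]%R <= (expR (- (t ^+ 2 / (2 * v))))%:E)%E.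
Proof.
move=> v0 t0 bv; pose a := t / v.
have a0 : 0 <= a by rewrite divr_ge0 // ltW.
apply: le_trans (chernoff_le (a := a) t (measurable_linear_form b) a0 _) _.
  have -> : (fun w => (expR (a * linear_form b w))%:E)
      = (fun w => (expR (linear_form (fun i => a * b i) w))%:E).
    apply/funext => w; congr (expR _)%:E; rewrite /linear_form mulr_sumr.
    by apply: eq_bigr => i _; rewrite mulrA.
  exact: linear_form_mgf.
rewrite lee_fin -expRD ler_expR.
under eq_bigr do rewrite exprMn.
rewrite -mulr_sumr.
have -> : t ^+ 2 / (2 * v) = a ^+ 2 * v / 2 by rewrite /a; field; rewrite gt_eqF.
have -> : a * t = a ^+ 2 * v by rewrite /a; field; rewrite gt_eqF.
have := ler_wpM2l (sqr_ge0 a) bv.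
lra.
Qed.

Lemma linear_form_abs_tail (b : I -> R) (v t : R) : 0 < v -> 0 <= t ->
  sigma ^+ 2 * \sum_i b i ^+ 2 <= v ->
  (P [set w | t <= `|linear_form b w|]%R <= (2 * expR (- (t ^+ 2 / (2 * v))))%:E)%E.
Proof.
move=> v0 t0 bv.
have m b' := measurable_superlevel t (measurable_linear_form b').
have -> : [set w | t <= `|linear_form b w|]
    = [set w | t <= linear_form b w] `|` [set w | t <= linear_form (fun i => - b i) w].
  have N w : linear_form (fun i => - b i) w = - linear_form b w.
    by rewrite /linear_form -sumrN; apply: eq_bigr => i _; rewrite mulNr.
  by apply/seteqP; split => w /=; rewrite N ler_normr => /orP.
apply: le_trans (measureU2 _ _ _) _; [exact: m|exact: m|].
rewrite mulrDl mul1r EFinD; apply: leeD; apply: linear_form_tail => //.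
by under eq_bigr do rewrite sqrrN.
Qed.

(* For a standard Gaussian g, exp(a L^2) = E_g exp(sqrt(2 a) g L): each square is
   linearized this way, and Tonelli reduces to linear_form_mgf. *)
Lemma quadratic_form_mgf (J : eqType) (y : J -> I -> R) (a : R) (S : seq J) (b : I -> R) :
  uniq S -> {in S &, forall c c', \sum_i y c i * y c' i = (c == c')%:R} ->
  0 <= a -> a * sigma ^+ 2 < 2^-1 -> {in S, forall c, \sum_i b i * y c i = 0} ->
  (\int[P]_w (expR (linear_form b w + a * \sum_(c <- S) linear_form (y c) w ^+ 2))%:E
   = (expR (sigma ^+ 2 / 2 * \sum_i b i ^+ 2)
      * (Num.sqrt (1 - 2 * (a * sigma ^+ 2)))^-1 ^+ size S)%:E)%E.
Proof.
move=> + + a0 a2; elim: S b => [|c S IHS] b /=.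
  move=> _ _ _; rewrite expr0 mulr1 -linear_form_mgf.
  by apply: eq_integral => w _; rewrite big_nil mulr0 addr0.
move=> /andP[cS uS] orth bS.
pose r := Num.sqrt (2 * a).
pose F (z : T * measurableTypeR R) : \bar R := (expR (linear_form b z.1
  + r * z.2 * linear_form (y c) z.1 + a * \sum_(c <- S) linear_form (y c) z.1 ^+ 2))%:E.
have mF : measurable_fun setT F.
  have m1 b' : measurable_fun setT (fun z : T * measurableTypeR R => linear_form b' z.1).
    by apply: measurableT_comp (measurable_linear_form b') _; exact: measurable_fst.
  have m2 : measurable_fun setT (fun z : T * measurableTypeR R => z.2 : R).
    exact: measurable_snd.
  apply/measurable_EFinP; apply: measurableT_comp => //.
  apply: measurable_funD; first apply: measurable_funD => //.
    by apply: measurable_funM => //; exact: measurable_funM.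
  apply: measurable_funM => //; apply: measurable_sum => k.
  exact: measurable_funX.
have F0 z : (0 <= F z)%E by rewrite lee_fin expR_ge0.
have r2 : r ^+ 2 = 2 * a by rewrite sqr_sqrtr // mulr_ge0.
transitivity (\int[P]_w \int[normal_prob 0 1]_g F (w, g))%E.
  apply: eq_integral => w _; rewrite /F /=.
  set A := linear_form b w; set B := \sum_(c <- S) _; set L := linear_form (y c) w.
  transitivity (\int[normal_prob 0 1]_g ((expR (A + a * B))%:E * (expR (r * L * g))%:E))%E.
    rewrite ge0_integralZl ?lee_fin ?expR_ge0 //.
    2: by apply/measurable_EFinP; apply: measurableT_comp => //; exact: measurable_funM.
    rewrite normal_mgf ?oner_eq0 // -EFinM -expRD; congr (expR _)%:E.
    rewrite big_cons -/B -/L exprMn r2; by field.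
  by apply: eq_integral => g _; rewrite -EFinM -expRD; congr (expR _)%:E; ring.
rewrite (fubini_tonelli F mF F0).
have bc : \sum_i b i * y c i = 0 by rewrite bS // mem_head.
(* For fixed [g], the vector [b + r g y_c] is still orthogonal to the remaining [y], so the
   induction hypothesis applies. Its squared norm is [|b|^2 + 2 a g^2], because [b] is orthogonal to
   the unit vector [y_c]. *)
have inner g : (\int[P]_w F (w, g) = (expR (sigma ^+ 2 / 2 * \sum_i b i ^+ 2)
    * (Num.sqrt (1 - 2 * (a * sigma ^+ 2)))^-1 ^+ size S)%:E
    * (expR (a * sigma ^+ 2 * g ^+ 2))%:E)%E.
  transitivity (\int[P]_w (expR (linear_form (fun i => b i + r * g * y c i) w
      + a * \sum_(c <- S) linear_form (y c) w ^+ 2))%:E)%E.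
    apply: eq_integral => w _; rewrite /F /=; congr (expR (_ + _))%:E.
    rewrite /linear_form mulr_sumr -big_split; apply: eq_bigr => i _ /=.
    by rewrite mulrDl mulrA.
  rewrite IHS //; last 2 first.
  - by move=> c1 c2 c1S c2S; apply: orth; rewrite in_cons ?c1S ?c2S orbT.
  - move=> c' c'S.
    transitivity (\sum_i b i * y c' i + r * g * \sum_i y c i * y c' i).
      by rewrite mulr_sumr -big_split; apply: eq_bigr => i _ /=; ring.
    rewrite bS ?in_cons ?c'S ?orbT // add0r orth ?mem_head ?in_cons ?c'S ?orbT //.
    by case: eqP => [cc'|]; [rewrite cc' c'S in cS|rewrite mulr0].
  rewrite -EFinM; congr (_%:E); rewrite [RHS]mulrAC -expRD; congr (expR _ * _).
  have -> : \sum_i (b i + r * g * y c i) ^+ 2 = \sum_i b i ^+ 2 + r ^+ 2 * g ^+ 2.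
    transitivity (\sum_i (b i ^+ 2 + 2 * r * g * (b i * y c i) + r ^+ 2 * g ^+ 2 * (y c i * y c i))).
      by apply: eq_bigr => i _; ring.
    rewrite !big_split /= -!mulr_sumr bc mulr0 addr0 orth ?mem_head //.
    by rewrite eqxx mulr1.
  by rewrite r2; field.
under eq_integral do rewrite inner.
rewrite ge0_integralZl ?lee_fin ?mulr_ge0 ?expR_ge0 ?exprn_ge0 ?invr_ge0 ?sqrtr_ge0 //.
2: by apply/measurable_EFinP; apply: measurableT_comp => //; apply: measurable_funM => //.
(* Integrating over [g] contributes one more factor [(1 - 2 a sigma^2)^(-1/2)]. *)
by rewrite normal_square_mgf // -EFinM; congr (_%:E); rewrite (exprSr _ (size S)) [RHS]mulrA.
Qed.

End gaussian_vector.

(** * Upper tail of the chi-square distribution *)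

Section chi_square.
Variable R : realType.

(** After squaring, [exp(z) >= 1 + z] reduces the claim to [(1 + 2x + 8x^2)(1 - 2x) = 1 + 4x^2 (1 -
    4x) >= 1]. *)
Lemma invr_sqrt_le_expR (x : R) : 0 <= x -> x <= 4^-1 ->
  (Num.sqrt (1 - 2 * x))^-1 <= expR (x + 4 * x ^+ 2).
Proof.
move=> x0 x4; have y0 : 0 < 1 - 2 * x by lra.
rewrite -[leLHS]mul1r ler_pdivrMr ?sqrtr_gt0 //.
rewrite -ler_sqr ?nnegrE ?mulr_ge0 ?expR_ge0 ?sqrtr_ge0 //.
rewrite exprMn sqr_sqrtr ?(ltW y0) // expr1n -expRM_natl.
apply: (@le_trans _ _ ((1 + 2%:R * (x + 4 * x ^+ 2)) * (1 - 2 * x))).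
  have : 0 <= x ^+ 2 * (1 - 4 * x) by rewrite mulr_ge0 ?sqr_ge0 //; lra.
  nra.
by rewrite ler_wpM2r ?(ltW y0) // expR_ge1Dx.
Qed.

Context d (T : measurableType d) (P : probability T R).
Variables (I : finType) (sigma : R) (X : I -> {RV P >-> R}).
Hypotheses (sigma_gt0 : 0 < sigma) (X_iid : iid_gaussian sigma X).

(** Chernoff with parameter [x / sigma^2] leaves the exponent [4 k x^2 - x u], where [k] is the size
    of [S]. The two terms of the minimum are the Gaussian regime of small [u] and the exponential
    regime of large [u]. *)
Lemma quadratic_form_tail (J : eqType) (y : J -> I -> R) (S : seq J) (L : R) :
  uniq S -> {in S &, forall c c', \sum_i y c i * y c' i = (c == c')%:R} ->
  (0 < size S)%N -> 0 <= L ->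
  (P [set w | sigma ^+ 2 * ((size S)%:R + Num.sqrt ((size S)%:R * L))
              <= \sum_(c <- S) linear_form X (y c) w ^+ 2]%R
   <= (expR (- Num.min (16^-1 * L) (8^-1 * Num.sqrt ((size S)%:R * L))))%:E)%E.
Proof.
move=> uS orth S0 L0; set k : R := (size S)%:R; set u := Num.sqrt (k * L).
have k0 : 0 < k by rewrite ltr0n.
have u0 : 0 <= u by exact: sqrtr_ge0.
have u2 : u ^+ 2 = k * L by rewrite sqr_sqrtr // mulr_ge0 // ltW.
have s2 : 0 < sigma ^+ 2 by rewrite exprn_gt0.
(* x minimizes 4 k x^2 - x u on [0, 1/4]. *)
have [x [x0 x4 xle]] : exists x, [/\ 0 <= x, x <= 4^-1 &
    k * (x + 4 * x ^+ 2) - x * (k + u) <= - Num.min (16^-1 * L) (8^-1 * u)].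
  have [uk|uk] := leP u (2 * k).
    exists (u / (8 * k)); split.
    - by rewrite divr_ge0 // mulr_ge0 // ltW.
    - by rewrite ler_pdivrMr ?mulr_gt0 //; lra.
    have -> : k * (u / (8 * k) + 4 * (u / (8 * k)) ^+ 2) - u / (8 * k) * (k + u)
        = - (16^-1 * L).
      have -> : L = u ^+ 2 / k by rewrite u2 mulrAC divff ?mul1r // gt_eqF.
      by field; rewrite gt_eqF.
    by rewrite lerN2 ge_min lexx.
  (* Here [u > 2k], so the exponent [k/4 - u/4] is at most [-u/8]. *)
  exists 4^-1; split; [lra|lra|].
  have : 8^-1 * u <= - (k * (4^-1 + 4 * 4^-1 ^+ 2) - 4^-1 * (k + u)).
    by rewrite (_ : 4 * 4^-1 ^+ 2 = 4^-1 :> R); [lra|field].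
  by move=> h; rewrite lerNr ge_min h orbT.
pose a := x / sigma ^+ 2.
have a0 : 0 <= a by rewrite divr_ge0 // ltW.
have as2 : a * sigma ^+ 2 = x by rewrite divfK // gt_eqF.
have mgf := quadratic_form_mgf sigma_gt0 X_iid (y := y) (a := a) (S := S) (b := fun=> 0) uS orth a0.
rewrite as2 in mgf.
have mY : measurable_fun setT (fun w => \sum_(c <- S) linear_form X (y c) w ^+ 2).
  by apply: measurable_sum => c; apply: measurable_funX; exact: measurable_linear_form.
have mgf' : (\int[P]_w (expR (a * \sum_(c <- S) linear_form X (y c) w ^+ 2))%:E
    = ((Num.sqrt (1 - 2 * x))^-1 ^+ size S)%:E)%E.
  have -> : ((Num.sqrt (1 - 2 * x))^-1 ^+ size S)%:E
      = (expR (sigma ^+ 2 / 2 * \sum_(i : I) 0 ^+ 2)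
      * (Num.sqrt (1 - 2 * x))^-1 ^+ size S)%:E.
    by rewrite big1 ?mulr0 ?expR0 ?mul1r // => i _; rewrite expr0n.
  rewrite -mgf; first (apply: eq_integral => w _; congr (expR _)%:E).
  - have -> : linear_form X (fun=> 0) w = 0.
      by rewrite /linear_form big1 // => i _; rewrite mul0r.
    by rewrite add0r.
  - by lra.
  - by move=> c _; rewrite big1 // => i _; rewrite mul0r.
apply: le_trans (chernoff_le _ mY a0 mgf') _.
rewrite lee_fin mulrA as2.
apply: (@le_trans _ _ (expR (- (x * (k + u))) * expR (x + 4 * x ^+ 2) ^+ size S)).
  rewrite ler_wpM2l ?expR_ge0 // lerXn2r ?nnegrE ?invr_ge0 ?sqrtr_ge0 ?expR_ge0 //.
  exact: invr_sqrt_le_expR.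
rewrite -expRM_natl -expRD ler_expR addrC; exact: xle.
Qed.

End chi_square.

(** * The two noise events *)

Section noise_events.
Context disp (T : measurableType disp) (R : realType) (P : probability T R).
Variables (n d1 d2 : nat) (e : rel 'I_n) (sigma : R).
Variable E : 'I_n * 'I_d1 * 'I_d2 -> {RV P >-> R}.
Hypothesis sigma_gt0 : 0 < sigma.
Hypothesis E_iid : iid_gaussian sigma E.

Definition noise_matrix (w : T) (i : 'I_n) : 'M[R]_(d1, d2) :=
  \matrix_(k, l) E (i, k, l) w.

Local Notation I := ('I_n * 'I_d1 * 'I_d2)%type.

(* The coefficients of the entry (k, l) of sum_i a_i N_i as a linear form in the
   noise. *)
Definition entry_coef (a : 'I_n -> R) (k : 'I_d1) (l : 'I_d2) (j : I) : R :=
  a j.1.1 * ((j.1.2 == k) && (j.2 == l))%:R.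

Lemma sum_triple (F : I -> R) : \sum_j F j = \sum_i \sum_k \sum_l F (i, k, l).
Proof.
by rewrite pair_bigA pair_bigA /=; apply: eq_bigr => -[[i k] l].
Qed.

Let sum_delta (k : 'I_d1) (l : 'I_d2) (F : 'I_d1 -> 'I_d2 -> R) :
  \sum_k' \sum_l' F k' l' * ((k' == k) && (l' == l))%:R = F k l.
Proof.
rewrite (bigD1 k) //= [X in _ + X]big1 ?addr0 => [|k' /negbTE kk]; last first.
  by rewrite big1 // => l' _; rewrite kk mulr0.
rewrite (bigD1 l) //= !eqxx mulr1 big1 ?addr0 // => l' /negbTE ->.
by rewrite mulr0.
Qed.

Lemma linear_form_entry a k l w :
  linear_form E (entry_coef a k l) w = (\sum_i a i *: noise_matrix w i) k l.
Proof.
rewrite /linear_form sum_triple summxE; apply: eq_bigr => i _.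
rewrite /entry_coef /= mxE [noise_matrix _ _ _ _]mxE.
rewrite -[RHS](sum_delta k l (fun k' l' => a i * E (i, k', l') w)).
by apply: eq_bigr => k' _; apply: eq_bigr => l' _; rewrite mulrAC.
Qed.

Lemma entry_coef_dot a a' k k' l l' :
  \sum_j entry_coef a k l j * entry_coef a' k' l' j
    = (\sum_i a i * a' i) * ((k == k') && (l == l'))%:R.
Proof.
rewrite sum_triple mulr_suml; apply: eq_bigr => i _; rewrite /entry_coef /=.
rewrite -(sum_delta k l (fun k0 l0 => a i * a' i * ((k0 == k') && (l0 == l'))%:R)).
by apply: eq_bigr => k0 _; apply: eq_bigr => l0 _; ring.
Qed.

Let C := component_roots e.
Let y := component_vec R e.
(** A triple [(c, k, l)] with [c] a root stands for the entry [(k, l)] of the component noise at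
    [c]. These [d kappa0] linear forms have orthonormal coefficients, so the energy is [sigma^2]
    times a chi-square variable. *)
Let S : seq I := enum (finset.setX (finset.setX C [set: 'I_d1]) [set: 'I_d2]).
Let coef (j : I) : I -> R := entry_coef (y j.1.1) j.1.2 j.2.

Let memS (j : I) :
  (j \in finset.setX (finset.setX C [set: 'I_d1]) [set: 'I_d2]) = (j.1.1 \in C).
Proof. by case: j => [[i k] l]; rewrite 2!finset.in_setX !finset.in_setT !andbT. Qed.

Lemma component_energy_linear_form w :
  component_energy e (noise_matrix w) = \sum_(j <- S) linear_form E (coef j) w ^+ 2.
Proof.
rewrite big_enum /= big_mkcond sum_triple /component_energy [LHS]big_mkcond.
apply: eq_bigr => c _; case: ifP => cC; last first.
  by rewrite big1 // => k _; rewrite big1 // => l _; rewrite memS cC.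
rewrite frobenius_norm_sqr; apply: eq_bigr => k _; apply: eq_bigr => l _.
by rewrite memS cC linear_form_entry expr2.
Qed.

Lemma size_component_entries : size S = (d1 * d2 * num_components e)%N.
Proof.
by rewrite -cardE !cardsX !cardsT !card_ord -(card_component_roots e) -mulnA mulnC.
Qed.

Lemma measure_bigsetU_le (J : Type) (s : seq J) (A : J -> set T) :
  (forall j, measurable (A j)) ->
  measurable (\big[setU/set0]_(j <- s) A j) /\
  (P (\big[setU/set0]_(j <- s) A j) <= \sum_(j <- s) P (A j))%E.
Proof.
move=> mA; elim: s => [|j s [ms Ps]]; first by rewrite !big_nil measure0.
rewrite !big_cons; split; first exact: measurableU.
by apply: le_trans (measureU2 _ _ _) _ => //; exact: leeD2l.
Qed.

(** The good event is the complement of [U], where some entry of [Bp N] reaches [t] in absolute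
    value, and of [V], where the component energy is large. *)
Lemma noise_event (nE : nat) (Bp : 'M[R]_(nE, n)) (smin L : R) :
  (0 < nE)%N -> (0 < d1 * d2)%N -> (0 < num_components e)%N -> 0 < smin -> 0 <= L ->
  (forall k, \sum_i Bp k i ^+ 2 <= smin^-1 ^+ 2) ->
  let d := (d1 * d2)%N in
  exists G : set T,
    [/\ measurable G,
        ((1 - 2 / (d * nE)%:R
          - expR (- Num.min (16^-1 * L) (8^-1 * Num.sqrt ((d * num_components e)%:R * L))))%:E
           <= P G)%E &
        forall w, G w ->
          (forall l, frobenius_norm (\sum_i Bp l i *: noise_matrix w i)
             <= 2 * sigma * Num.sqrt (d%:R * ln (d * nE)%:R) / smin) /\
          component_energy e (noise_matrix w)
             <= sigma ^+ 2 * ((d * num_components e)%:R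
                              + Num.sqrt ((d * num_components e)%:R * L))].
Proof.
move=> nE0 d0 kappa0 smin0 L0 Bple d.
have dnE0 : (0 < d * nE)%N by rewrite muln_gt0 d0.
have ln0 : 0 <= ln (d * nE)%:R :> R by rewrite ln_ge0 // ler1n.
(* An entry of [Bp N] has variance at most [v = sigma^2 / smin^2], and this [t] gives
   [t^2 / (2v) = 2 ln(d nE)]. Each two-sided tail is then at most [2 / (d nE)^2], and there are
   [d nE] entries. *)
pose t := 2 * sigma * Num.sqrt (ln (d * nE)%:R) / smin.
have t0 : 0 <= t by rewrite divr_ge0 ?mulr_ge0 ?sqrtr_ge0 ?ltW.
pose f (j : 'I_nE * 'I_d1 * 'I_d2) := entry_coef (Bp j.1.1) j.1.2 j.2.
pose A j := [set w | t <= `|linear_form E (f j) w|].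
have mA j : measurable (A j).
  by apply: measurable_superlevel; apply: measurableT_comp => //; exact: measurable_linear_form.
have [mU PU] := measure_bigsetU_le (index_enum ('I_nE * 'I_d1 * 'I_d2)%type) mA.
set U := \big[setU/set0]_(j <- _) A j in mU PU.
pose V := [set w | sigma ^+ 2 * ((size S)%:R + Num.sqrt ((size S)%:R * L))
              <= \sum_(j <- S) linear_form E (coef j) w ^+ 2].
have mV : measurable V.
  apply: measurable_superlevel; apply: measurable_sum => j; apply: measurable_funX.
  exact: measurable_linear_form.
have sizeE := size_component_entries.
have PV : (P V <= (expR (- Num.min (16^-1 * L) (8^-1 * Num.sqrt ((size S)%:R * L))))%:E)%E.
  apply: quadratic_form_tail => //.
  - exact: enum_uniq.
  - move=> j j'; rewrite !mem_enum !memS => jC j'C; rewrite /coef entry_coef_dot.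
    rewrite component_vec_orthonormal // -natrM mulnb; congr (_%:R).
    by case: j j' {jC j'C} => [[i k] l] [[i' k'] l'] /=; rewrite !xpair_eqE andbA.
  - by rewrite sizeE muln_gt0 d0.
have PA j : (P (A j) <= (2 / (d * nE)%:R ^+ 2)%:E)%E.
  have v0 : 0 < sigma ^+ 2 * smin^-1 ^+ 2 by rewrite mulr_gt0 ?exprn_gt0 ?invr_gt0.
  apply: le_trans (linear_form_abs_tail sigma_gt0 E_iid v0 t0 _) _.
    rewrite ler_wpM2l ?sqr_ge0 //; under eq_bigr do rewrite expr2.
    rewrite entry_coef_dot !eqxx mulr1; under eq_bigr do rewrite -expr2.
    exact: Bple.
  have -> : t ^+ 2 / (2 * (sigma ^+ 2 * smin^-1 ^+ 2)) = 2%:R * ln (d * nE)%:R.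
    rewrite /t !exprMn sqr_sqrtr //; field; rewrite !gt_eqF //.
  by rewrite lee_fin expRN expRM_natl lnK // posrE ltr0n.
have PU' : (P U <= (2 / (d * nE)%:R)%:E)%E.
  apply: (le_trans PU).
  apply: (@le_trans _ _ (\sum_(j : 'I_nE * 'I_d1 * 'I_d2) (2 / (d * nE)%:R ^+ 2)%:E)%E).
    by apply: lee_sum => j _; exact: PA.
  rewrite sumEFin lee_fin sumr_const !card_prod !card_ord.
  have -> : (nE * d1 * d2 = d * nE)%N by rewrite /d -mulnA mulnC.
  rewrite -[leLHS]mulr_natr expr2 invfM -!mulrA mulVf ?mulr1 //.
  by rewrite pnatr_eq0 -lt0n.
exists (~` (U `|` V)); split; first by apply: measurableC; exact: measurableU.
  rewrite probability_setC; last exact: measurableU.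
  have : (P (U `|` V) <= (2 / (d * nE)%:R
      + expR (- Num.min (16^-1 * L) (8^-1 * Num.sqrt ((size S)%:R * L))))%:E)%E.
    by apply: le_trans (measureU2 _ mU mV) _; rewrite EFinD; exact: leeD.
  rewrite -sizeE -[P (U `|` V)]fineK ?fin_num_measure //; last exact: measurableU.
  rewrite -EFinB !lee_fin; lra.
move=> w /not_orP [wU wV]; split; last first.
  rewrite component_energy_linear_form ltW // -sizeE ltNge; exact/negP.
move=> l; have entry_lt k j : `|(\sum_i Bp l i *: noise_matrix w i) k j| <= t.
  rewrite -linear_form_entry ltW // ltNge; apply/negP => tle; apply: wU.
  by rewrite /U -bigcup_seq; exists (l, k, j); rewrite //= mem_index_enum.
rewrite frobenius_normE.
(* A matrix with [d] entries of absolute value at most [t] has Frobenius norm at most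
   [sqrt(d) t]. *)
have -> : 2 * sigma * Num.sqrt (d%:R * ln (d * nE)%:R) / smin = Num.sqrt (d%:R * t ^+ 2).
  rewrite [RHS]sqrtrM // sqrtr_sqr (ger0_norm t0) [in LHS]sqrtrM // /t.
  by ring.
rewrite ler_wsqrtr //.
apply: (@le_trans _ _ (\sum_(k < d1) \sum_(j < d2) t ^+ 2)).
  apply: ler_sum => k _; apply: ler_sum => j _.
  by rewrite -expr2 -[leLHS]real_normK ?num_real // ler_sqr ?nnegrE.
by rewrite !sumr_const !card_ord -mulrnA mulnC mulr_natl.
Qed.

End noise_events.

(** * The finite-sample bound *)

Section finite_sample.
Variable R : realType.

(** Without edges every vertex is its own root, which makes [n] components. This provides an edge,
    hence a positive [sigma_min], once [n] exceeds the bound on the components. *)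
Lemma num_components_no_edges n (e : rel 'I_n) : symmetric e -> irreflexive e ->
  (num_components e < n)%N -> (0 < #|edges e|)%N.
Proof.
move=> e_sym e_irr; rewrite lt0n; apply: contraTneq => /cards0_eq edges0.
have eF i j : e i j = false.
  have lt_false (i' j' : 'I_n) : (i' < j')%N -> e i' j' = false.
    by move=> lt; have := finset.in_set0 (i', j'); rewrite -edges0 inE lt.
  case: (ltngtP i j) => [/lt_false //|/lt_false|/val_inj ->]; last exact: e_irr.
  by rewrite e_sym.
rewrite -leqNgt -[leqLHS]card_ord; apply: subset_leq_card.
apply/fintype.subsetP => i _; rewrite inE andbT.
suff rootE : fingraph.root e i = i by rewrite /fingraph.roots /= rootE.
by have /connectP[[|k p] /= + ->] := connect_root e i; rewrite ?eF.
Qed.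

Lemma num_components_gt0 n (e : rel 'I_n) : symmetric e -> (0 < n)%N ->
  (0 < num_components e)%N.
Proof.
case: n e => // n e e_sym _; apply/card_gt0P; exists (fingraph.root e ord0).
by rewrite inE andbT; exact/roots_root/sym_connect_sym.
Qed.

Lemma incidence_mx_neq0 n (e : rel 'I_n) : (0 < #|edges e|)%N -> incidence_mx R e != 0.
Proof.
move=> /card_gt0P[[i j] ij]; apply/eqP => /matrixP /(_ i (enum_rank_in ij (i, j))).
rewrite !mxE enum_rankK_in // eqxx /=; move: ij; rewrite inE /= => /andP[lt_ij _].
rewrite (_ : i == j = false) ?subr0 => [/eqP|]; first by rewrite oner_eq0.
by apply/negP => /eqP ij; rewrite ij ltnn in lt_ij.
Qed.

(** The last hypothesis before the conclusion bounds the component energy by [sigma^2 d sqrt(n)] on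
    the good event, as [(n^(1/4))^2 = sqrt(n)]; this is what controls the cross term with
    [gamma2]. *)
Lemma finite_sample_bound (n d1 d2 K : nat) (e : rel 'I_n) (w : 'I_n -> 'I_n -> R)
    (M : 'I_K -> 'M[R]_(d1, d2)) (s : 'I_n -> 'I_K) (sigma c gamma1 gamma2 : R)
    (disp : measure_display) (T : measurableType disp) (P : probability T R)
    (E : 'I_n * 'I_d1 * 'I_d2 -> {RV P >-> R}) :
  let d := (d1 * d2)%N in
  let nE := #|edges e| in
  let kappa0 := num_components e in
  let L := ln (d * n)%:R in
  (0 < n)%N -> (0 < d)%N -> (0 < nE)%N -> 0 < sigma -> 1 <= c ->
  symmetric e ->
  (forall i j : 'I_n, (i < j)%N -> e i j -> 2^-1 <= w i j) ->
  iid_gaussian sigma E ->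
  gamma1 = c * (4 * sigma * Num.sqrt (d%:R * ln (d * nE)%:R) / sigma_min (incidence_mx R e)) ->
  0 < gamma2 ->
  (d * kappa0)%:R + Num.sqrt ((d * kappa0)%:R * L) <= d%:R * (n%:R `^ 4^-1) ^+ 2 ->
  exists G : set T,
     [/\ measurable G,
         ((1 - 2 / (d * nE)%:R
           - expR (- Num.min (16^-1 * L) (8^-1 * Num.sqrt ((d * kappa0)%:R * L))))%:E
          <= P G)%E &
         forall omega, G omega -> forall X : 'I_n -> 'M[R]_(d1, d2),
           clustering_solution e w gamma1 gamma2 (noisy_data M s E omega) X ->
           (2 * d * n)%:R^-1 * (\sum_i frobenius_norm (X i - M (s i)) ^+ 2)
             <= estimation_error_bound e w gamma1 gamma2 sigma M s].
Proof.
move=> d nE kappa0 L n0 d0 nE0 sigma0 c1 e_sym w_ge E_iid gamma1E gamma20 growth.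
have kappa0_gt0 : (0 < kappa0)%N := num_components_gt0 e_sym n0.
have smin0 := sigma_min_gt0 (incidence_mx_neq0 nE0).
set smin := sigma_min _ in smin0 gamma1E.
have [Bp [Bple Bp_split]] := identity_split R e_sym.
have L0 : 0 <= L by rewrite ln_ge0 // ler1n muln_gt0 d0.
have [G [mG PG GP]] := noise_event sigma0 E_iid nE0 d0 kappa0_gt0 smin0 L0 Bple.
exists G; split => // omega /GP[G_le energy_le] X X_opt.
set N := noise_matrix E omega in G_le energy_le.
have gamma1_ge0 : 0 <= gamma1.
  rewrite gamma1E; apply: mulr_ge0; first by lra.
  by rewrite divr_ge0 ?mulr_ge0 ?sqrtr_ge0 ?ltW.
(* The bound of the noise event is [gamma1 / 2] for [c = 1]; a larger [c] only increases the
   right-hand side. *)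
have G_le' l : frobenius_norm (\sum_i Bp l i *: N i) <= gamma1 / 2.
  apply: le_trans (G_le l) _; rewrite gamma1E -/d -/nE -/smin.
  pose q := Num.sqrt (d%:R * ln (d * nE)%:R) / smin.
  have q0 : 0 <= sigma * q by rewrite !mulr_ge0 ?invr_ge0 ?sqrtr_ge0 ?ltW.
  have -> : 2 * sigma * Num.sqrt (d%:R * ln (d * nE)%:R) / smin = 2 * (sigma * q).
    by rewrite /q !mulrA.
  have -> : c * (4 * sigma * Num.sqrt (d%:R * ln (d * nE)%:R) / smin) / 2 = 2 * (c * (sigma * q)).
    by rewrite /q; field; rewrite gt_eqF.
  by rewrite ler_pM2l // ler_peMl.
have := clustering_error_bound (M := fun i => M (s i)) e_sym gamma1_ge0 (ltW gamma20) w_ge Bp_split X_opt G_le'.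
set S := component_energy e N in energy_le *.
set W := \sum_(p in _) _; set Nn := \sum_i nuclear_norm _; set Q := \sum_i frobenius_norm _ ^+ 2.
move=> main; rewrite /estimation_error_bound -/d -/kappa0 -/L -/W -/Nn.
have S0 : 0 <= S by rewrite sumr_ge0 // => i _; exact: sqr_ge0.
set r := n%:R `^ 4^-1 in growth *.
have nR : 0 < n%:R :> R by rewrite ltr0n.
have dR : 0 < d%:R :> R by rewrite ltr0n.
have r0 : 0 < r by rewrite powR_gt0.
have r4 : r ^+ 4 = n%:R.
  by rewrite -powR_mulrn ?(ltW r0) // /r -powRrM mulVf ?powRr1 ?(ltW nR).
have sqrtn : Num.sqrt n%:R = r ^+ 2.
  by rewrite -r4 (exprM r 2 2) sqrtr_sqr ger0_norm // sqr_ge0.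
have sqrtd2 : Num.sqrt d2%:R <= Num.sqrt d%:R :> R.
  rewrite ler_wsqrtr // ler_nat /d leq_pmull //.
  by move: d0; rewrite muln_gt0 => /andP[].
have sqrtS : Num.sqrt S <= sigma * (Num.sqrt d%:R * r).
  have -> : sigma * (Num.sqrt d%:R * r) = Num.sqrt (sigma ^+ 2 * (d%:R * r ^+ 2)).
    rewrite [RHS]sqrtrM ?sqr_ge0 // sqrtr_sqr (gtr0_norm sigma0).
    by rewrite [in RHS]sqrtrM ?(ltW dR) // sqrtr_sqr (gtr0_norm r0).
  rewrite ler_wsqrtr //; apply: le_trans energy_le _.
  by rewrite ler_wpM2l ?sqr_ge0.
(* With [r = n^(1/4)], the product is at most [d r^3 sigma = d n sigma / r]. *)
have cross : Num.sqrt d2%:R * (Num.sqrt n%:R * Num.sqrt S) <= (d * n)%:R * (sigma / r).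
  apply: (@le_trans _ _ (Num.sqrt d%:R * (r ^+ 2 * (sigma * (Num.sqrt d%:R * r))))).
    rewrite sqrtn; apply: ler_pM => //; first by rewrite mulr_ge0 ?sqr_ge0 ?sqrtr_ge0.
    by rewrite ler_wpM2l ?sqr_ge0.
  have -> : Num.sqrt d%:R * (r ^+ 2 * (sigma * (Num.sqrt d%:R * r)))
    = Num.sqrt d%:R ^+ 2 * r ^+ 4 * (sigma / r) by field; rewrite gt_eqF.
  by rewrite sqr_sqrtr ?(ltW dR) // r4 natrM.
have dn0 : 0 < (d * n)%:R :> R by rewrite natrM mulr_gt0.
have dE x : (d * x)%:R = d%:R * x%:R :> R by rewrite natrM.
(* Puts the deviation term over the common denominator [d n], by which the whole inequality is then
   multiplied. *)
have split_sqrt : Num.sqrt (kappa0%:R * L / (d * n ^ 2)%:R)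
    = Num.sqrt ((d * kappa0)%:R * L) / (d * n)%:R.
  transitivity (Num.sqrt ((d * kappa0)%:R * L * (d * n)%:R^-1 ^+ 2)).
    by congr Num.sqrt; rewrite !dE natrX; field; rewrite !gt_eqF.
  by rewrite sqrtrM ?mulr_ge0 // sqrtr_sqr ger0_norm // invr_ge0 ltW.
have -> : (2 * d * n)%:R^-1 * Q = (2^-1 * Q) / (d * n)%:R.
  by rewrite -mulnA natrM invfM; ring.
rewrite ler_pdivrMr //; apply: le_trans main _.
rewrite split_sqrt.
have E1 : sigma ^+ 2 * (kappa0%:R / n%:R + Num.sqrt ((d * kappa0)%:R * L) / (d * n)%:R) * (d * n)%:R
  = sigma ^+ 2 * ((d * kappa0)%:R + Num.sqrt ((d * kappa0)%:R * L)).
  by rewrite !dE; field; rewrite !gt_eqF.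
have E2 : gamma1 / (2 * d * n)%:R * W * (d * n)%:R = gamma1 / 2 * W.
  by rewrite -mulnA (natrM _ 2) !dE; field; rewrite !gt_eqF.
have E3 : gamma2 * (sigma / r + (d * n)%:R^-1 * Nn) * (d * n)%:R
   = gamma2 * ((d * n)%:R * (sigma / r)) + gamma2 * Nn.
  by rewrite !dE; field; rewrite !gt_eqF.
rewrite !mulrDl E1 E2 E3.
have cross' := ler_wpM2l (ltW gamma20) cross.
rewrite [leLHS]mulrA in cross'; move: energy_le; rewrite -/d -/kappa0 => energy_le.
by rewrite [leRHS]addrA lerD2r [leRHS]addrAC lerD2r; exact: lerD.
Qed.

End finite_sample.

(** * Asymptotics *)

Section asymptotics.
Variable R : realType.

Lemma eqO1_bounded (f : nat -> R) : f =O_\oo (fun=> 1 : R) ->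
  exists2 C, 0 < C & \forall m \near \oo, f m <= C.
Proof.
move=> /eqOP [C0 [C0real fC]]; exists (Num.max 1 (C0 + 1)).
  by rewrite lt_max ltr01.
have := fC (Num.max 1 (C0 + 1)).
rewrite lt_max ltrDl ltr01 orbT => /(_ erefl); apply: filterS => m.
by rewrite normr1 mulr1; exact: le_trans (ler_norm _).
Qed.

Lemma quarter_power4 (k : nat) : (k%:R `^ 4^-1) ^+ 4 = k%:R :> R.
Proof.
by rewrite -powR_mulrn ?powR_ge0 // -powRrM mulVf ?powRr1.
Qed.

(** From [sqrt(ab) <= a + b] and [ln(dn) <= d + 4r], the left side is at most [2dC + d + 4r], which
    is at most [d r^2] for [r >= 2C + 5] and [d >= 1]. *)
Lemma component_growth (d n kappa : nat) (C : R) : (0 < d)%N -> (0 < n)%N ->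
  kappa%:R <= C -> 2 * C + 5 <= n%:R `^ 4^-1 ->
  (d * kappa)%:R + Num.sqrt ((d * kappa)%:R * ln (d * n)%:R)
    <= d%:R * (n%:R `^ 4^-1) ^+ 2 :> R.
Proof.
move=> d0 n0 kC; set r := n%:R `^ 4^-1 => r_ge.
have dR : 1 <= d%:R :> R by rewrite ler1n.
have nR : 0 < n%:R :> R by rewrite ltr0n.
have r0 : 0 < r by rewrite powR_gt0.
have k0 : 0 <= kappa%:R :> R by [].
have L0 : 0 <= ln (d * n)%:R :> R by rewrite ln_ge0 // ler1n muln_gt0 d0.
(* [ln n = 4 ln r], and a logarithm is below its argument. *)
have L_le : ln (d * n)%:R <= d%:R + 4 * r.
  rewrite natrM lnM ?posrE ?ltr0n //; apply: lerD.
    by apply/ltW/ln_sublinear; rewrite ltr0n.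
  rewrite -{1}(quarter_power4 n) lnXn // -[leLHS]mulr_natl.
  by rewrite ler_pM2l // ltW // ln_sublinear.
have sqrt_le (a b : R) : 0 <= a -> 0 <= b -> Num.sqrt (a * b) <= a + b.
  move=> a0 b0; rewrite -[leRHS]ger0_norm ?addr_ge0 // -sqrtr_sqr ler_wsqrtr //.
  have := sqr_ge0 (a + b); have := mulr_ge0 a0 b0; nra.
have := sqrt_le (d * kappa)%:R _ (ler0n _ _) L0.
rewrite natrM.
set q := Num.sqrt _ => qle.
have : 0 <= d%:R * (C - kappa%:R) by rewrite mulr_ge0 // subr_ge0.
have h2 : 0 <= (d%:R - 1) * r by rewrite mulr_ge0 ?subr_ge0 // ltW.
have h3 : 0 <= d%:R * (r * (r - (2 * C + 5))).
  by rewrite !mulr_ge0 ?subr_ge0 // ltW.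
have h4 : 0 <= d%:R * (C * (r - (2 * C + 5))).
  by rewrite !mulr_ge0 ?subr_ge0 // (le_trans k0).
have h5 : 0 <= d%:R * (r - (2 * C + 5)).
  by rewrite !mulr_ge0 ?subr_ge0.
have C0 : 0 <= C := le_trans k0 kC.
have h6 : 0 <= d%:R * (C * C) by rewrite !mulr_ge0.
have h7 : 0 <= d%:R * C by rewrite !mulr_ge0.
move: qle L_le; move: (ln _) => L; rewrite expr2; move=> *.
nra.
Qed.

Lemma cvg_nat_inv (n : nat -> nat) : n @ \oo --> \oo ->
  (fun m => (n m)%:R^-1 : R) @ \oo --> (0 : R).
Proof.
move=> ny; apply/cvgr0Pnorm_le => eps eps0.
near=> m.
have hm : ((Num.bound eps^-1).+1 <= n m)%N by near: m; exact: ((cvgnyPge _).1 ny).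
 have n0 : (0 < n m)%N by apply: leq_trans hm.
rewrite ger0_norm ?invr_ge0 // -[leRHS]invrK lef_pV2 ?posrE ?invr_gt0 ?ltr0n //.
apply: le_trans (_ : (Num.bound eps^-1)%:R <= _); last by rewrite ler_nat ltnW.
by apply/ltW/archi_boundP; rewrite invr_ge0 ltW.
Unshelve. all: by end_near. Qed.

Lemma cvg_quarter_power (n : nat -> nat) (A : R) : n @ \oo --> \oo ->
  \forall m \near \oo, A <= (n m)%:R `^ 4^-1.
Proof.
move=> ny; near=> m.
have hm : (Num.bound `|A| ^ 4 <= n m)%N by near: m; exact: ((cvgnyPge _).1 ny).
apply: le_trans (_ : (Num.bound `|A|)%:R <= _).
  by apply/ltW/(le_lt_trans (ler_norm _)); exact: archi_boundP.
rewrite -(@ler_pXn2r _ 4) ?nnegrE ?powR_ge0 //.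
by rewrite quarter_power4 -natrX ler_nat.
Unshelve. all: by end_near. Qed.

End asymptotics.

Section error_bound_limit.
Variable R : realType.

Lemma eqo1_cvg (f : nat -> R) : f =o_\oo (fun=> 1 : R) -> f @ \oo --> (0 : R).
Proof.
move=> /eqoP fo; apply/cvgr0Pnorm_le => eps eps0.
near=> m; rewrite -[leRHS]mulr1 -[X in _ * X](normr1 R).
by near: m; exact: fo.
Unshelve. all: by end_near. Qed.

(** Since [ln(dn) <= dn], the quantity under the root is at most [C / n], and both summands vanish
    with [1 / n]. *)
Lemma variance_term_cvg (sigma C : R) (n d kappa : nat -> nat) :
  n @ \oo --> \oo -> d @ \oo --> \oo ->
  (\forall m \near \oo, (kappa m)%:R <= C) ->
  (fun m => sigma ^+ 2 * ((kappa m)%:R / (n m)%:R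
     + Num.sqrt ((kappa m)%:R * ln (d m * n m)%:R / (d m * n m ^ 2)%:R))) @ \oo --> (0 : R).
Proof.
move=> ny dy kC.
apply: (@squeeze_cvgr _ _ _ _ (fun=> 0 : R)
    (fun m => sigma ^+ 2 * (C * (n m)%:R^-1 + Num.sqrt (C * (n m)%:R^-1)))).
- near=> m.
  have n0 : (0 < n m)%N by near: m; exact: ((cvgnyPge _).1 ny).
  have d0 : (0 < d m)%N by near: m; exact: ((cvgnyPge _).1 dy).
  have kCm : (kappa m)%:R <= C by near: m.
  have L0 : 0 <= ln (d m * n m)%:R :> R by rewrite ln_ge0 // ler1n muln_gt0 d0.
  apply/andP; split.
    by rewrite mulr_ge0 ?sqr_ge0 // addr_ge0 ?sqrtr_ge0 // divr_ge0.
  rewrite ler_wpM2l ?sqr_ge0 // lerD ?ler_wsqrtr //; first by rewrite ler_wpM2r ?invr_ge0.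
  rewrite ler_pdivrMr ?ltr0n ?muln_gt0 ?d0 ?expn_gt0 ?n0 //.
  rewrite -mulrA; apply: ler_pM => //.
  have -> : (n m)%:R^-1 * (d m * n m ^ 2)%:R = (d m * n m)%:R :> R.
    rewrite !natrM; field; rewrite gt_eqF // ltr0n //.
  by apply/ltW/ln_sublinear; rewrite ltr0n muln_gt0 d0.
- exact: cvg_cst.
have x0 : (fun m => C * (n m)%:R^-1) @ \oo --> (0 : R).
  by rewrite -[X in _ --> X](mulr0 C); apply: cvgMr; exact: cvg_nat_inv.
rewrite -[X in _ --> X](mulr0 (sigma ^+ 2)); apply: cvgMr.
rewrite -[X in _ --> X](addr0 0); apply: cvgD => //.
rewrite -[X in _ --> X](@sqrtr0 R).
exact: (continuous_cvg _ (@sqrt_continuous R 0) x0).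
Unshelve. all: by end_near. Qed.

End error_bound_limit.

Theorem mainTheorem4 (R : realType) :
  exists c1 c2 : R, [/\ 0 < c1, 0 < c2 &
  forall (sigma c : R) (n d1 d2 K : nat -> nat)
    (e : forall m, rel 'I_(n m)) (w : forall m, 'I_(n m) -> 'I_(n m) -> R)
    (M : forall m, 'I_(K m) -> 'M[R]_(d1 m, d2 m))
    (s : forall m, 'I_(n m) -> 'I_(K m))
    (gamma1 gamma2 : nat -> R)
    (disp : nat -> measure_display) (T : forall m, measurableType (disp m))
    (P : forall m, probability (T m) R)
    (E : forall m, 'I_(n m) * 'I_(d1 m) * 'I_(d2 m) -> {RV (P m) >-> R}),
  let d := fun m => (d1 m * d2 m)%N in
  let nE := fun m => #|edges (@e m)| in
  let kappa0 := fun m => num_components (@e m) in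
  let smin := fun m => sigma_min (incidence_mx R (@e m)) in
  let bound := fun m => estimation_error_bound (@e m) (@w m)
                          (gamma1 m) (gamma2 m) sigma (@M m) (@s m) in
  0 < sigma ->
  1 <= c ->
  (forall m, (d2 m <= d1 m)%N) ->
  n @ \oo --> \oo ->
  d @ \oo --> \oo ->
  (forall m, symmetric (@e m)) ->
  (forall m, irreflexive (@e m)) ->
  (forall m (i j : 'I_(n m)), (i < j)%N -> e m i j -> 2^-1 <= w m i j) ->
  (forall m, iid_gaussian sigma (@E m)) ->
  (fun m => (smin m)^-1 *
     Num.sqrt ((nE m)%:R ^+ 2 * ln (d m * nE m)%:R / (d m * n m ^ 2)%:R))
    =o_\oo (fun=> 1 : R) ->
  (fun m => (kappa0 m)%:R : R) =O_\oo (fun=> 1 : R) ->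
  (fun m => max_weight (@e m) (@w m)) =O_\oo (fun=> 1 : R) ->
  (fun m => tau_max (@M m)) =O_\oo (fun=> 1 : R) ->
  (fun m => Delta_max (@M m)) =O_\oo (fun=> 1 : R) ->
  (forall m, gamma1 m =
     c * (4 * sigma * Num.sqrt ((d m)%:R * ln (d m * nE m)%:R) / smin m)) ->
  (forall m, 0 < gamma2 m) ->
  gamma2 =o_\oo (fun m => Num.min ((n m)%:R `^ 4^-1) (d m)%:R) ->
  (\forall m \near \oo, exists G : set (T m),
     [/\ measurable G,
         ((1 - 2 / (d m * nE m)%:R
             - 2 * expR (- (Num.sqrt (d m ^ 3 * n m)%:R / 2))
             - expR (- Num.min (c1 * ln (d m * n m)%:R)
                 (c2 * Num.sqrt ((d m * kappa0 m)%:R * ln (d m * n m)%:R))))%:E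
          <= P m G)%E &
         forall omega, G omega -> forall X : 'I_(n m) -> 'M[R]_(d1 m, d2 m),
           clustering_solution (@e m) (@w m) (gamma1 m) (gamma2 m)
             (noisy_data (@M m) (@s m) (@E m) omega) X ->
           (2 * d m * n m)%:R^-1 *
             (\sum_i frobenius_norm (X i - M m (s m i)) ^+ 2) <= bound m]) /\
  bound @ \oo --> (0 : R)].
Proof.
(* These are the constants of the chi-square tail, independent of all the data. *)
exists 16^-1, 8^-1; split; [by lra|by lra|].
move=> sigma c n d1 d2 K e w M s gamma1 gamma2 disp T P E d nE kappa0 smin bound.
move=> sigma0 c1 _ n_oo d_oo e_sym e_irr w_ge E_iid smin_o kappa_O w_O tau_O Delta_O.
move=> gamma1E gamma2_gt0 gamma2_o.
have [Ck Ck0 kappa_le] := eqO1_bounded kappa_O.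
have [Cw Cw0 w_le] := eqO1_bounded w_O.
have [Ct Ct0 tau_le] := eqO1_bounded tau_O.
have [CD CD0 Delta_le] := eqO1_bounded Delta_O.
have n_ge k : \forall m \near \oo, (k <= n m)%N by exact: ((cvgnyPge _).1 n_oo).
have d_gt0 : \forall m \near \oo, (0 < d m)%N by exact: ((cvgnyPge _).1 d_oo).
(* The number of components stays bounded while [n] grows, so eventually the graph has an edge. *)
have nE_gt0 : \forall m \near \oo, (0 < nE m)%N.
  near=> m; apply: num_components_no_edges => //.
  have kCm : (kappa0 m)%:R <= Ck by near: m.
  have nm : ((Num.bound Ck).+1 <= n m)%N by near: m; exact: n_ge.
  apply: leq_trans nm; rewrite ltnS -(ler_nat R).
  by apply: le_trans kCm _; apply/ltW/archi_boundP/ltW.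
split.
  near=> m.
  have n0 : (0 < n m)%N by near: m; exact: n_ge.
  have d0 : (0 < d m)%N by near: m.
  have nE0 : (0 < nE m)%N by near: m.
  have kCm : (kappa0 m)%:R <= Ck by near: m.
  have rm : 2 * Ck + 5 <= (n m)%:R `^ 4^-1 by near: m; exact: cvg_quarter_power.
  have growth := component_growth d0 n0 kCm rm.
  have [G [mG PG GP]] := finite_sample_bound (M m) (s m) n0 d0 nE0 sigma0 c1 (@e_sym m)
    (@w_ge m) (E_iid m) (gamma1E m) (gamma2_gt0 m) growth.
  exists G; split => //; apply: le_trans PG; rewrite lee_fin.
  (* The stated probability subtracts a further nonnegative exponential from the bound in [PG]. *)
  by apply: lerD; [rewrite lerBlDr lerDl mulr_ge0 ?expR_ge0|exact: lexx].
have T1 := variance_term_cvg sigma n_oo d_oo kappa_le.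
(* Each edge contributes at most [(1 + 2 Cw) CD], so the fusion term is at most a constant times the
   quantity assumed to be [o(1)]. *)
have T2 : (fun m => gamma1 m / (2 * d m * n m)%:R
    * (\sum_(p in edges (@e m)) (1 + 2 * w m p.1 p.2)
        * frobenius_norm (M m (s m p.1) - M m (s m p.2)))) @ \oo --> (0 : R).
  apply: (@squeeze_cvgr _ _ _ _ (fun=> 0 : R) (fun m => 2 * c * sigma * (1 + 2 * Cw) * CD *
     ((smin m)^-1 * Num.sqrt ((nE m)%:R ^+ 2 * ln (d m * nE m)%:R / (d m * n m ^ 2)%:R)))).
  - near=> m.
    have n0 : (0 < n m)%N by near: m; exact: n_ge.
    have d0 : (0 < d m)%N by near: m.
    have nE0 : (0 < nE m)%N by near: m.
    have wm : max_weight (@e m) (@w m) <= Cw by near: m.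
    have Dm : Delta_max (@M m) <= CD by near: m.
    have smin_gt0 : 0 < smin m by apply: sigma_min_gt0; exact: incidence_mx_neq0.
    have gamma1_ge0 : 0 <= gamma1 m.
      rewrite gamma1E; apply: mulr_ge0; first exact: le_trans c1.
      by rewrite divr_ge0 ?mulr_ge0 ?sqrtr_ge0 ?(ltW sigma0) ?(ltW smin_gt0).
    have coef_ge0 p : p \in edges (@e m) -> 0 <= 1 + 2 * w m p.1 p.2.
      rewrite inE => /andP[p12 ep]; have := w_ge m _ _ p12 ep; lra.
    apply/andP; split.
      rewrite mulr_ge0 ?divr_ge0 // sumr_ge0 // => p pe.
      by rewrite mulr_ge0 ?coef_ge0 ?frobenius_norm_ge0.
    have sum_le : \sum_(p in edges (@e m)) (1 + 2 * w m p.1 p.2)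
        * frobenius_norm (M m (s m p.1) - M m (s m p.2)) <= (nE m)%:R * ((1 + 2 * Cw) * CD).
      rewrite mulr_natl -sumr_const; apply: ler_sum => p pe.
      apply: ler_pM; rewrite ?coef_ge0 ?frobenius_norm_ge0 //.
        rewrite lerD2l ler_pM2l //; apply: le_trans wm.
        exact: (le_bigmax_cond _ (fun p => w m p.1 p.2)).
      apply: le_trans Dm; apply: le_trans (le_bigmax _ _ (s m p.1)).
      exact: (le_bigmax _ (fun b => frobenius_norm (M m (s m p.1) - M m b)) (s m p.2)).
    apply: le_trans (ler_wpM2l _ sum_le) _; first by rewrite divr_ge0.
    have dR : 0 < (d m)%:R :> R by rewrite ltr0n.
    have nR : 0 < (n m)%:R :> R by rewrite ltr0n.
    have ln0 : 0 <= ln (d m * nE m)%:R :> R by rewrite ln_ge0 // ler1n muln_gt0 d0.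
    have -> : Num.sqrt ((nE m)%:R ^+ 2 * ln (d m * nE m)%:R / (d m * n m ^ 2)%:R)
        = (nE m)%:R * Num.sqrt ((d m)%:R * ln (d m * nE m)%:R) / ((d m)%:R * (n m)%:R) :> R.
      transitivity (Num.sqrt (((nE m)%:R / ((d m)%:R * (n m)%:R)) ^+ 2
          * ((d m)%:R * ln (d m * nE m)%:R)) : R).
        congr Num.sqrt; rewrite (natrM _ (d m) (n m ^ 2)) natrX; field.
        by rewrite !gt_eqF.
      rewrite sqrtrM ?sqr_ge0 // sqrtr_sqr ger0_norm ?divr_ge0 ?mulr_ge0 ?(ltW dR) ?(ltW nR) //.
      by rewrite mulrAC.
    rewrite le_eqVlt; apply/orP; left; apply/eqP; rewrite gamma1E -/(smin m).
    rewrite -mulnA (natrM _ 2) (natrM _ (d m)); field.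
    by rewrite !gt_eqF.
  - exact: cvg_cst.
  rewrite -[X in _ --> X](mulr0 (2 * c * sigma * (1 + 2 * Cw) * CD)); apply: cvgMr.
  exact: eqo1_cvg.
(* With [mu = min(n^(1/4), d)], the bracket is at most [(sigma + Ct) / mu], while eventually
   [gamma2 <= eps mu / (sigma + Ct)]; the product is at most [eps]. *)
have T3 : (fun m => gamma2 m * (sigma / ((n m)%:R `^ 4^-1)
     + (d m * n m)%:R^-1 * (\sum_i nuclear_norm (M m (s m i))))) @ \oo --> (0 : R).
  apply/cvgr0Pnorm_le => eps eps0.
  have sC : 0 < sigma + Ct by rewrite addr_gt0.
  near=> m.
  have n0 : (0 < n m)%N by near: m; exact: n_ge.
  have d0 : (0 < d m)%N by near: m.
  have tm : tau_max (@M m) <= Ct by near: m.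
  have dR : 0 < (d m)%:R :> R by rewrite ltr0n.
  have nR : 0 < (n m)%:R :> R by rewrite ltr0n.
  have r0 : 0 < (n m)%:R `^ 4^-1 :> R by rewrite powR_gt0.
  have gm : `|gamma2 m| <= eps / (sigma + Ct) * `|Num.min ((n m)%:R `^ 4^-1) (d m)%:R|.
    by near: m; move/eqoP: gamma2_o; apply; rewrite divr_gt0.
  rewrite gtr0_norm // ger0_norm ?le_min ?(ltW r0) ?(ltW dR) // in gm.
  have nuc_le : (d m * n m)%:R^-1 * (\sum_i nuclear_norm (M m (s m i))) <= Ct / (d m)%:R.
    have : \sum_i nuclear_norm (M m (s m i)) <= (n m)%:R * Ct.
      rewrite mulr_natl -[X in _ *+ X](card_ord (n m)) -sumr_const; apply: ler_sum => i _.
      by apply: le_trans tm; exact: (le_bigmax _ (fun a => nuclear_norm (M m a))).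
    move=> /(ler_wpM2l (_ : 0 <= (d m * n m)%:R^-1)) h; apply: le_trans (h _) _ => //.
    rewrite le_eqVlt; apply/orP; left; apply/eqP; rewrite (natrM _ (d m)); field.
    by rewrite !gt_eqF.
  have nuc_ge0 : 0 <= (d m * n m)%:R^-1 * (\sum_i nuclear_norm (M m (s m i))).
    by rewrite mulr_ge0 // sumr_ge0 // => i _; exact: nuclear_norm_ge0.
  rewrite ger0_norm ?mulr_ge0 ?addr_ge0 ?divr_ge0 ?(ltW sigma0) ?(ltW (gamma2_gt0 m)) ?(ltW r0) //.
  set mu := Num.min _ _ in gm.
  have mu0 : 0 < mu by rewrite lt_min r0.
  have part : sigma / (n m)%:R `^ 4^-1 + (d m * n m)%:R^-1 * (\sum_i nuclear_norm (M m (s m i)))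
      <= (sigma + Ct) / mu.
    rewrite mulrDl; apply: lerD.
      by rewrite ler_pM2l // lef_pV2 // ge_min lexx.
    apply: le_trans nuc_le _.
    by rewrite ler_pM2l // lef_pV2 // ge_min lexx orbT.
  apply: le_trans (ler_pM _ _ gm part) _; rewrite ?(ltW (gamma2_gt0 m)) //.
    by rewrite addr_ge0 // divr_ge0 // ltW.
  rewrite le_eqVlt; apply/orP; left; apply/eqP; field.
  by rewrite !gt_eqF.
have := cvgD (cvgD T1 T2) T3; rewrite !addr0; exact.
Unshelve. all: by end_near.
Qed.
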